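(* Let $C(x)=(x\wedge x')\vee(x\wedge x')^*$, $T(x)=C(x)\wedge C(x)'$, $\gamma(x,y)=T(x)^*\vee C(y)$, and for $n\ge1$ let $$\beta(x_0,\ldots,x_{n-1})=(x_0\wedge\cdots\wedge x_{n-1})^*\vee\bigvee_{i<n}(x_0\wedge\cdots\wedge x_{i-1}\wedge x_i^*\wedge x_{i+1}\wedge\cdots\wedge x_{n-1})^*.$$ For every pseudocomplemented Kleene algebra $L$ and every $n\ge 1$: - $L\in\mathcal{BPK}$ if and only if $L\models x^*\wedge\gamma(x,y)\approx x^*$; - $L\in\mathcal{BPK}_1$ if and only if $L\models\gamma(y,x)\approx\gamma(x,y)$; - $L\in\mathcal{BPK}_0$ if and only if $L\models x^*\wedge\gamma(x,y)\approx x^*$ and $L\models C(x)\wedge C(x)'\approx C(x)'$; - $L\in\mathcal{V}(\mathbb{B}_{(n,1)})$ if and only if $L\models x^*\wedge\gamma(x,y)\approx x^*$, $L\models C(x)\wedge C(x)'\approx C(x)'$ and $L\models\beta(x_0,\ldots,x_{n-1})\approx1$; - $L\in\mathcal{V}(\mathbb{B}_{(n,2)})$ if and only if $L\models\gamma(y,x)\approx\gamma(x,y)$ and $L\models\beta(x_0,\ldots,x_{n-1})\approx1$; - $L\in\mathcal{V}(\mathbb{B}_{(n,3)})$ if and only if $L\models x^*\wedge\gamma(x,y)\approx x^*$ and $L\models\beta(x_0,\ldots,x_{n-1})\approx1$.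
   Context: A pseudocomplemented Kleene algebra ($pk$-algebra) is an algebra $\langle L,\wedge,\vee,{}',{}^*,0,1\rangle$ such that $\langle L,\wedge,\vee,0,1\rangle$ is a bounded distributive lattice, $x''=x$, $(x\wedge y)'=x'\vee y'$, $x\wedge x'\le y\vee y'$, and $a\wedge b=0\Leftrightarrow b\le a^*$. $\mathcal{BPK}$ (bundle pseudocomplemented Kleene algebras) is the variety generated by the subdirectly irreducible $pk$-algebras $L$ such that, in the set of prime filters of $L$ ordered by inclusion, every maximal element contains all non-maximal elements. For bounded distributive lattices, $L_1\oplus L_2$ is the ordinal sum ($L_2$ placed above $L_1$) with $1^{L_1}$ and $0^{L_2}$ identified. For $i\ge1$, $m\in\{1,2,3\}$, $\mathbb{B}_{(i,m)}$ is the $pk$-algebra with lattice $B_i\oplus C_m\oplus B_i$, where $B_i$ is the Boolean lattice with $i$ atoms and $C_m$ the $m$-element chain; ${}'$ is the order-reversing involution sending $a$ in the lower copy of $B_i$ to the element of the upper copy corresponding to the Boolean complement of $a$ (and vice versa) and reversing $C_m$; ${}^*$ is the pseudocomplement. $\mathcal{V}(A)$ is the variety generated by $A$. $\mathcal{BPK}_0$ is the variety generated by $\{\mathbb{B}_{(i,1)}:i\ge1\}$ and $\mathcal{BPK}_1$ is the variety generated by $\{\mathbb{B}_{(i,1)}:i\ge1\}\cup\{\mathbb{B}_{(i,2)}:i\ge1\}$. *)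

(* Defs.v *)
From HB Require Import structures.
From mathcomp Require Import all_boot all_order.
From mathcomp Require Import boolp classical_sets.

Set Implicit Arguments.
Unset Strict Implicit.
Unset Printing Implicit Defensive.

Import Order.Theory Order.DefaultSetSubsetOrder.
Local Open Scope order_scope.

(* 0 = 1 is allowed, so the one-element algebra is a pk-algebra. *)
HB.mixin Record isPKAlgebra d L of Order.TBDistrLattice d L := {
  pkneg : L -> L;
  pkstar : L -> L;
  pknegK : forall x, pkneg (pkneg x) = x;
  pknegI : forall x y, pkneg (x `&` y) = pkneg x `|` pkneg y;
  pknegIU : forall x y, x `&` pkneg x <= y `|` pkneg y;
  pkstarP : forall x y, x `&` y = \bot <-> y <= pkstar x
}.

#[short(type="pkAlgebraType")]
HB.structure Definition PKAlgebra d :=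
  {L of isPKAlgebra d L & Order.TBDistrLattice d L}.

Record pk_morphism d d' (A : pkAlgebraType d) (B : pkAlgebraType d')
    (f : A -> B) : Prop := PKMorphism {
  pk_morphI : {morph f : x y / x `&` y};
  pk_morphU : {morph f : x y / x `|` y};
  pk_morph0 : f \bot = \bot;
  pk_morph1 : f \top = \top;
  pk_morphN : {morph f : x / pkneg x};
  pk_morphS : {morph f : x / pkstar x}
}.

(* Classes of algebras are plain predicates: [set (pkAlgebraType d)] would     *)
(* conflict with the universe constraints of the instances on [set].           *)

Definition closedH d (K : pkAlgebraType d -> Prop) : Prop :=
  forall (A B : pkAlgebraType d) (f : A -> B),
    pk_morphism f -> (forall y, exists x, f x = y) -> K A -> K B.

(* Subalgebras are taken up to isomorphism. *)
Definition closedS d (K : pkAlgebraType d -> Prop) : Prop :=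
  forall (A B : pkAlgebraType d) (f : B -> A),
    pk_morphism f -> injective f -> K A -> K B.

(* Direct products are taken up to isomorphism: the last premise but one says  *)
(* that x |-> (p i x)_i is a bijection from P onto the cartesian product.      *)
Definition closedP d (K : pkAlgebraType d -> Prop) : Prop :=
  forall (I : Type) (A : I -> pkAlgebraType d) (P : pkAlgebraType d)
    (p : forall i, P -> A i),
    (forall i, pk_morphism (p i)) ->
    (forall a : (forall i, A i), exists! x : P, forall i, p i x = a i) ->
    (forall i, K (A i)) -> K P.

Definition is_variety d (K : pkAlgebraType d -> Prop) : Prop :=
  [/\ closedH K, closedS K & closedP K].

Definition variety_of d (K : pkAlgebraType d -> Prop) : pkAlgebraType d -> Prop :=
  fun L => forall V : pkAlgebraType d -> Prop,
    is_variety V -> (forall A, K A -> V A) -> V L.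

(* The f i are the components of a subdirect embedding of L into the product   *)
(* of the A i. Taking I empty shows that the trivial algebra is excluded.      *)
Definition subdirectly_irreducible d (L : pkAlgebraType d) : Prop :=
  forall (I : Type) (A : I -> pkAlgebraType d) (f : forall i, L -> A i),
    (forall i, pk_morphism (f i)) ->
    (forall i y, exists x, f i x = y) ->
    (forall x y, (forall i, f i x = f i y) -> x = y) ->
    exists i, injective (f i).

Definition prime_filter d (L : tbDistrLatticeType d) (F : set L) : Prop :=
  [/\ F \top, ~ F \bot,
      forall x y, x <= y -> F x -> F y,
      forall x y, F x -> F y -> F (x `&` y)
    & forall x y, F (x `|` y) -> F x \/ F y].

Definition maximal_prime_filter d (L : tbDistrLatticeType d) (F : set L) : Prop :=
  prime_filter F /\ forall G : set L, prime_filter G -> (F `<=` G)%classic -> G = F.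

Definition bundle d (L : tbDistrLatticeType d) : Prop :=
  forall F G : set L, maximal_prime_filter F ->
    prime_filter G -> ~ maximal_prime_filter G -> (G `<=` F)%classic.

Definition BPK d : pkAlgebraType d -> Prop :=
  variety_of (fun A : pkAlgebraType d => subdirectly_irreducible A /\ bundle A).

(* The ordinal sum with 1 of L1 and 0 of L2 identified is realized as the      *)
(* sublattice {(a, b) | a = 1 or b = 0} of the product: a in L1 becomes (a, 0) *)
(* and b in L2 becomes (1, b). The display d of the sum is arbitrary.          *)

Definition osum_pred d1 d2 d (L1 : tbDistrLatticeType d1)
    (L2 : tbDistrLatticeType d2) : pred (L1 *prod[d] L2) :=
  fun x => (x.1 == \top) || (x.2 == \bot).

Record osum d1 d2 (d : Order.disp_t) (L1 : tbDistrLatticeType d1)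
    (L2 : tbDistrLatticeType d2) : Type :=
  OSum { osum_val : L1 *prod[d] L2; _ : osum_pred osum_val }.

Section OrdinalSum.
Context (d1 d2 d : Order.disp_t).
Context (L1 : tbDistrLatticeType d1) (L2 : tbDistrLatticeType d2).
Notation T := (osum d L1 L2).
Notation prd := (L1 *prod[d] L2).

HB.instance Definition _ := [isSub for @osum_val d1 d2 d L1 L2].
HB.instance Definition _ := [Choice of T by <:].

Fact osum_meet_closed : meet_closed (@osum_pred d1 d2 d L1 L2).
Proof.
move=> [a b] [a' b'] /=; rewrite !unfold_in /=.
case/orP=> /eqP /= ->; case/orP=> /eqP /= ->; by rewrite ?meetxx ?meet0x ?meetx0 ?eqxx ?orbT.
Qed.

Fact osum_join_closed : join_closed (@osum_pred d1 d2 d L1 L2).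
Proof.
move=> [a b] [a' b'] /=; rewrite !unfold_in /=.
case/orP=> /eqP /= ->; case/orP=> /eqP /= ->; by rewrite ?joinxx ?join1x ?joinx1 ?eqxx ?orbT.
Qed.

Fact osum_bot : (\bot : prd) \in @osum_pred d1 d2 d L1 L2.
Proof. by rewrite unfold_in /= eqxx orbT. Qed.

Fact osum_top : (\top : prd) \in @osum_pred d1 d2 d L1 L2.
Proof. by rewrite unfold_in /= eqxx. Qed.

HB.instance Definition _ := Order.SubChoice_isTBSubLattice.Build _ prd _ d T
  osum_meet_closed osum_join_closed osum_bot osum_top.

Fact osum_meetUl : @left_distributive T T Order.meet Order.join.
Proof. by move=> x y z; apply: val_inj; rewrite /= meetUl. Qed.

HB.instance Definition _ := Order.Lattice_Meet_isDistrLattice.Build d T osum_meetUl.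

Fact osum_lower_subproof (a : L1) : osum_pred ((a, \bot) : prd).
Proof. by rewrite /osum_pred /= eqxx orbT. Qed.

Fact osum_upper_subproof (b : L2) : osum_pred ((\top, b) : prd).
Proof. by rewrite /osum_pred /= eqxx. Qed.

Lemma osum_leE (x y : T) : (x <= y) =
  ((osum_val x).1 <= (osum_val y).1) && ((osum_val x).2 <= (osum_val y).2).
Proof. by []. Qed.

Lemma osum_valI (x y : T) : osum_val (x `&` y) =
  ((osum_val x).1 `&` (osum_val y).1, (osum_val x).2 `&` (osum_val y).2).
Proof. by []. Qed.

Lemma osum_valU (x y : T) : osum_val (x `|` y) =
  ((osum_val x).1 `|` (osum_val y).1, (osum_val x).2 `|` (osum_val y).2).
Proof. by []. Qed.

Lemma osum_val0 : osum_val (\bot : T) = (\bot, \bot).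
Proof. by []. Qed.

Lemma osum_val1 : osum_val (\top : T) = (\top, \top).
Proof. by []. Qed.

Definition osum_lower (a : L1) : T := OSum (osum_lower_subproof a).
Definition osum_upper (b : L2) : T := OSum (osum_upper_subproof b).

End OrdinalSum.

(* Triggers the inference of the bounded distributive lattice 'I_n.+1. *)
HB.instance Definition _ n := Order.TBPreorder.on (ordinal n.+1).

(* For m = 0 this is B_(i,1). *)
Definition pkB (d : Order.disp_t) (i m : nat) : Type :=
  osum d (osum d {set 'I_i} 'I_m.-1.+1) {set 'I_i}.

Section BPlusCPlusB.
Context (d : Order.disp_t) (i m : nat).
Notation Bi := {set 'I_i}.
Notation Cm := 'I_m.-1.+1.
Notation T := (pkB d i m).

HB.instance Definition _ :=
  Order.TBDistrLattice.copy T (osum d (osum d Bi Cm) Bi).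

(* An element has coordinates (a, c, b) in B_i x C_m x B_i: a in the lower     *)
(* copy of B_i has coordinates (a, 0, 0), c in C_m has (1, c, 0), and b in the *)
(* upper copy has (1, 1, b).                                                   *)
Definition pkB_lower (a : Bi) : T := osum_lower d _ (osum_lower d _ a).
Definition pkB_middle (c : Cm) : T := osum_lower d _ (osum_upper d _ c).
Definition pkB_upper (b : Bi) : T := osum_upper d _ b.

Definition pkB_lo (x : T) : Bi := (osum_val (osum_val x).1).1.
Definition pkB_mid (x : T) : Cm := (osum_val (osum_val x).1).2.
Definition pkB_up (x : T) : Bi := (osum_val x).2.

Lemma pkB_ext (x y : T) :
  pkB_lo x = pkB_lo y -> pkB_mid x = pkB_mid y -> pkB_up x = pkB_up y -> x = y.
Proof.
case: x => -[[[a c] ac] b] xP; case: y => -[[[a' c'] ac'] b'] yP.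
rewrite /pkB_lo /pkB_mid /pkB_up /= => aE cE bE; apply: val_inj => /=.
by congr pair => //; apply: val_inj => /=; congr pair.
Qed.

Lemma pkB_leE (x y : T) :
  (x <= y) = [&& pkB_lo x <= pkB_lo y, pkB_mid x <= pkB_mid y & pkB_up x <= pkB_up y].
Proof. by rewrite !osum_leE -andbA. Qed.

Lemma pkB_loI x y : pkB_lo (x `&` y) = pkB_lo x `&` pkB_lo y.
Proof. by rewrite /pkB_lo !osum_valI. Qed.
Lemma pkB_midI x y : pkB_mid (x `&` y) = pkB_mid x `&` pkB_mid y.
Proof. by rewrite /pkB_mid !osum_valI. Qed.
Lemma pkB_upI x y : pkB_up (x `&` y) = pkB_up x `&` pkB_up y.
Proof. by rewrite /pkB_up !osum_valI. Qed.
Lemma pkB_loU x y : pkB_lo (x `|` y) = pkB_lo x `|` pkB_lo y.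
Proof. by rewrite /pkB_lo !osum_valU. Qed.
Lemma pkB_midU x y : pkB_mid (x `|` y) = pkB_mid x `|` pkB_mid y.
Proof. by rewrite /pkB_mid !osum_valU. Qed.
Lemma pkB_upU x y : pkB_up (x `|` y) = pkB_up x `|` pkB_up y.
Proof. by rewrite /pkB_up !osum_valU. Qed.


Variant pkB_spec (x : T) : Prop :=
| PkBLower a of x = pkB_lower a
| PkBMiddle c of x = pkB_middle c
| PkBUpper b of x = pkB_upper b.

Lemma pkBP x : pkB_spec x.
Proof.
have : osum_pred (osum_val (osum_val x).1) by case: (osum_val x).1.
have : osum_pred (osum_val x) by case: x.
rewrite /osum_pred; case/orP=> /eqP; last first.
  move=> b0; case/orP=> /eqP.
    by move=> a1; apply: (PkBMiddle (c := pkB_mid x)); apply: pkB_ext.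
  by move=> c0; apply: (PkBLower (a := pkB_lo x)); apply: pkB_ext.
move=> y1 _; apply: (PkBUpper (b := pkB_up x)).
by apply: pkB_ext => //; rewrite /pkB_lo /pkB_mid y1.
Qed.

(* x' is computed by reversing the coordinates and dualizing each of them.     *)

Fact pkB_neg_inner x : osum_pred ((~` pkB_up x, rev_ord (pkB_mid x)) : Bi *prod[d] Cm).
Proof.
rewrite /osum_pred; case: (pkBP x) => [a|c|b] -> /=; rewrite ?compl0 ?eqxx //.
by apply/orP; right; apply/eqP/val_inj => /=; rewrite subnn.
Qed.

Fact pkB_neg_outer x :
  osum_pred ((OSum (pkB_neg_inner x), ~` pkB_lo x) : osum d Bi Cm *prod[d] Bi).
Proof.
rewrite /osum_pred; case: (pkBP x) => [a|c|b] -> /=; rewrite ?compl1 ?eqxx ?orbT //.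
apply/orP; left; apply/eqP/val_inj => /=; congr pair; first exact: compl0.
by apply: val_inj; rewrite /= subn1.
Qed.

Definition pkB_neg x : T := OSum (pkB_neg_outer x).

Lemma pkB_lo_neg x : pkB_lo (pkB_neg x) = ~` pkB_up x. Proof. by []. Qed.
Lemma pkB_mid_neg x : pkB_mid (pkB_neg x) = rev_ord (pkB_mid x). Proof. by []. Qed.
Lemma pkB_up_neg x : pkB_up (pkB_neg x) = ~` pkB_lo x. Proof. by []. Qed.

Lemma pkB_neg_lower a : pkB_neg (pkB_lower a) = pkB_upper (~` a).
Proof.
apply: pkB_ext => //=; first exact: compl0.
by apply: val_inj; rewrite /= subn1.
Qed.

Lemma pkB_neg_middle c : pkB_neg (pkB_middle c) = pkB_middle (rev_ord c).
Proof. by apply: pkB_ext => //=; [exact: compl0 | exact: compl1]. Qed.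

Lemma pkB_neg_upper b : pkB_neg (pkB_upper b) = pkB_lower (~` b).
Proof.
apply: pkB_ext => //=; last exact: compl1.
by apply: val_inj; rewrite /= subnn.
Qed.

Definition pkB_star x : T :=
  if x == \bot then \top else pkB_lower (~` pkB_lo x).

Fact pkB_negK x : pkB_neg (pkB_neg x) = x.
Proof.
by apply: pkB_ext; rewrite !(pkB_lo_neg, pkB_mid_neg, pkB_up_neg) ?complK ?rev_ordK.
Qed.

Fact pkB_negI x y : pkB_neg (x `&` y) = pkB_neg x `|` pkB_neg y.
Proof.
apply: pkB_ext.
- by rewrite pkB_loU !pkB_lo_neg pkB_upI complI.
- rewrite pkB_midU !pkB_mid_neg pkB_midI; apply: le_anti.
  rewrite leUx; case: (leP (pkB_mid x) (pkB_mid y)) => xy; rewrite lexx ?andbT /=.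
    by rewrite lexU lexx /=; apply: leq_sub2l; rewrite ltnS.
  by rewrite lexU lexx orbT /=; apply: leq_sub2l; rewrite ltnS; exact: (ltW xy).
- by rewrite pkB_upU !pkB_up_neg pkB_loI complI.
Qed.

Fact pkB_negIU x y : x `&` pkB_neg x <= y `|` pkB_neg y.
Proof.
rewrite pkB_leE !(pkB_loI, pkB_midI, pkB_upI, pkB_loU, pkB_midU, pkB_upU).
rewrite !(pkB_lo_neg, pkB_mid_neg, pkB_up_neg); apply/and3P; split.
- case: (pkBP y) => [a|c|b] -> /=; last by rewrite join1x lex1.
  + by rewrite [X in _ `|` X]compl0 joinx1 lex1.
  + by rewrite join1x lex1.
- rewrite leIx !lexU; case: (leP (pkB_mid x) (pkB_mid y)) => //= yx.
  by apply/orP; right; apply/orP; right; apply: leq_sub2l; rewrite ltnS; exact: (ltW yx).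
- case: (pkBP x) => [a|c|b] -> /=.
  + by rewrite meet0x le0x.
  + by rewrite meet0x le0x.
  + by rewrite [X in _ `&` X]compl1 meetx0 le0x.
Qed.

Fact pkB_lo_eq1 x : (pkB_mid x != \bot) || (pkB_up x != \bot) -> pkB_lo x = \top.
Proof. by case: (pkBP x) => [a|c|b] -> //; rewrite /pkB_mid /pkB_up /= eqxx. Qed.

Fact pkB_mid_eq1 x : pkB_up x != \bot -> pkB_mid x = \top.
Proof. by case: (pkBP x) => [a|c|b] -> //; rewrite /pkB_up /= eqxx. Qed.

Fact pkB_starP x y : x `&` y = \bot <-> y <= pkB_star x.
Proof.
rewrite /pkB_star; case: eqP => [-> | x_neq0]; first by rewrite meet0x lex1.
rewrite pkB_leE; split=> [xy0 | /and3P[]]; last first.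
  rewrite !lex0 => yx /eqP y_mid /eqP y_up; apply: pkB_ext.
  - by rewrite pkB_loI; apply/eqP; rewrite meetC disj_leC.
  - by rewrite pkB_midI y_mid meetx0.
  - by rewrite pkB_upI y_up meetx0.
have lo0 : pkB_lo x `&` pkB_lo y = \bot by rewrite -pkB_loI xy0.
have mid0 : pkB_mid x `&` pkB_mid y = \bot by rewrite -pkB_midI xy0.
have x0 : pkB_lo x = \bot -> pkB_mid x = \bot -> False.
  move=> lx mx; apply: x_neq0; apply: pkB_ext => //; apply/eqP.
  case: eqP => // /eqP ux; apply/esym/negbTE; move: (ux).
  by rewrite -lex0 -lx (pkB_lo_eq1 (x := x)) ?ux ?orbT // lex1.
apply/and3P; split; first by rewrite -disj_leC meetC lo0.
- rewrite lex0; apply/negP => /negP my.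
  apply: x0; first by rewrite -[LHS]meetx1 -(pkB_lo_eq1 (x := y)) ?my.
  move: mid0; case: (leP (pkB_mid x) (pkB_mid y)) => // _ my0.
  by rewrite my0 eqxx in my.
- rewrite lex0; apply/negP => /negP uy; apply: x0.
  + by rewrite -[LHS]meetx1 -(pkB_lo_eq1 (x := y)) ?uy ?orbT.
  + by rewrite -[LHS]meetx1 -(pkB_mid_eq1 (x := y)).
Qed.

HB.instance Definition _ :=
  isPKAlgebra.Build d T pkB_negK pkB_negI pkB_negIU pkB_starP.

End BPlusCPlusB.

Definition pkB_variety d (n m : nat) : pkAlgebraType d -> Prop :=
  variety_of (fun A : pkAlgebraType d => A = pkB d n m).

Definition BPK0 d : pkAlgebraType d -> Prop :=
  variety_of (fun A : pkAlgebraType d => exists2 i, (0 < i)%N & A = pkB d i 1).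

Definition BPK1 d : pkAlgebraType d -> Prop :=
  variety_of (fun A : pkAlgebraType d =>
    exists2 i, (0 < i)%N & A = pkB d i 1 \/ A = pkB d i 2).

Definition pkC d (L : pkAlgebraType d) (x : L) : L :=
  (x `&` pkneg x) `|` pkstar (x `&` pkneg x).

Definition pkT d (L : pkAlgebraType d) (x : L) : L := pkC x `&` pkneg (pkC x).

Definition pkgamma d (L : pkAlgebraType d) (x y : L) : L :=
  pkstar (pkT x) `|` pkC y.

Definition pkbeta d (L : pkAlgebraType d) (n : nat) (x : 'I_n -> L) : L :=
  pkstar (\meet_(j < n) x j) `|`
  \join_(i < n) pkstar (\meet_(j < n) (if j == i then pkstar (x j) else x j)).

(* Main.v *)
Require Import Defs.
From HB Require Import structures.
From mathcomp Require Import all_boot all_order.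
From mathcomp Require Import boolp classical_sets.

Set Implicit Arguments.
Unset Strict Implicit.
Unset Printing Implicit Defensive.

Import Order.Theory Order.DefaultSetSubsetOrder.
Local Open Scope order_scope.

(** The prime filters of a pk-algebra, ordered by inclusion, carry the order-reversing
  involution [pkdual P], the set of the [x] with [pkneg x] not in [P]; every prime
  filter is comparable with its image ([pkdual_comparable]), and [pkstar x] lies in a
  prime filter iff [x] lies in no maximal prime filter above it.  Read at a prime
  filter, each of the identities becomes a statement about this poset.

  The identity [pkstar x `&` pkgamma x y = pkstar x] says that a non-maximal prime
  filter [P] below a maximal [Q] is below every maximal [R] containing [pkdual Q]
  ([bundle_identity_filter]).  It follows that the maximal filters are partitioned
  into clusters, where [R] is in the cluster of [Q] if it contains [pkdual Q], and
  that the poset around a prime filter is that of some B + C + B, with C a chain of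
  at most three elements and B a possibly infinite Boolean lattice: a cluster on top,
  its image under the involution at the bottom, and in between at most a filter and
  its dual.  The identity on [pkC] forbids such middle filters, the symmetry of
  [pkgamma] makes them self-dual, and the identity on [pkbeta] bounds the size of
  every cluster by [n].

  To pass from this picture to membership in a generated variety, finite
  approximations suffice: an algebra belongs to a variety as soon as, for every finite
  set [Z], its points are separated by maps to members of the variety that respect all
  the operations except that [pkstar] is respected on [Z] only ([local_embedding]).
  Finitely many members of a cluster witness the values of [pkstar] on [Z], and
  evaluation at them, at their duals and at the filters in between is such a map to
  some [pkB d i m] ([dual_eval_partial]).

  In the other direction, the algebras satisfying an identity form a variety, so that
  it is enough to check the generators.  An algebra whose prime filters form a bundle
  satisfies the first identity ([bundle_satisfies_identity]), and the others are
  computed in [pkB d i m].  Finally [BPK] contains all the algebras used above because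
  [pkB d i 3] is a subdirectly irreducible bundle with quotient [pkB d i 1]. *)

(** * Products and subalgebras *)

Definition pk_prod d (I : Type) (A : I -> pkAlgebraType d) : Type := forall i, A i.

Section Product.
Context d (I : Type) (A : I -> pkAlgebraType d).
Notation T := (pk_prod A).
Implicit Types f g h : T.

HB.instance Definition _ := gen_eqMixin T.
HB.instance Definition _ := gen_choiceMixin T.

Let ple f g := `[< forall i, f i <= g i >].
Let pmeet f g : T := fun i => f i `&` g i.
Let pjoin f g : T := fun i => f i `|` g i.

Fact pk_prod_le_refl : reflexive ple.
Proof. by move=> f; apply/asboolP. Qed.

Fact pk_prod_le_anti : antisymmetric ple.
Proof.
move=> f g /andP[/asboolP fg /asboolP gf]; apply: functional_extensionality_dep => i.
by apply: le_anti; rewrite fg gf.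
Qed.

Fact pk_prod_le_trans : transitive ple.
Proof.
by move=> g f h /asboolP fg /asboolP gh; apply/asboolP => i; apply: le_trans (gh i).
Qed.

HB.instance Definition _ := Order.Le_isPOrder.Build d T
  pk_prod_le_refl pk_prod_le_anti pk_prod_le_trans.

Lemma pk_prod_leP f g : reflect (forall i, f i <= g i) (f <= g).
Proof. exact: asboolP. Qed.

Lemma pk_prod_ext f g : (forall i, f i = g i) -> f = g.
Proof. exact: functional_extensionality_dep. Qed.

Fact pk_prod_meetC : commutative pmeet.
Proof. by move=> f g; apply: pk_prod_ext => i; apply: meetC. Qed.
Fact pk_prod_joinC : commutative pjoin.
Proof. by move=> f g; apply: pk_prod_ext => i; apply: joinC. Qed.
Fact pk_prod_meetA : associative pmeet.
Proof. by move=> f g h; apply: pk_prod_ext => i; apply: meetA. Qed.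
Fact pk_prod_joinA : associative pjoin.
Proof. by move=> f g h; apply: pk_prod_ext => i; apply: joinA. Qed.
Fact pk_prod_joinKI g f : pmeet f (pjoin f g) = f.
Proof. by apply: pk_prod_ext => i; apply: joinKI. Qed.
Fact pk_prod_meetKU g f : pjoin f (pmeet f g) = f.
Proof. by apply: pk_prod_ext => i; apply: meetKU. Qed.
Fact pk_prod_leEmeet f g : (f <= g) = (pmeet f g == f).
Proof.
apply/pk_prod_leP/eqP => [fg | <- i]; last exact: leIr.
by apply: pk_prod_ext => i; apply/meet_idPl/fg.
Qed.
Fact pk_prod_meetUl : left_distributive pmeet pjoin.
Proof. by move=> f g h; apply: pk_prod_ext => i; apply: meetUl. Qed.

HB.instance Definition _ := Order.POrder_Meet_isDistrLattice.Build d T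
  pk_prod_meetC pk_prod_joinC pk_prod_meetA pk_prod_joinA
  pk_prod_joinKI pk_prod_meetKU pk_prod_leEmeet pk_prod_meetUl.

Fact pk_prod_le0x f : ((fun i => \bot) : T) <= f.
Proof. by apply/pk_prod_leP => i; apply: le0x. Qed.
Fact pk_prod_lex1 f : f <= ((fun i => \top) : T).
Proof. by apply/pk_prod_leP => i; apply: lex1. Qed.

HB.instance Definition _ := Order.hasBottom.Build d T pk_prod_le0x.
HB.instance Definition _ := Order.hasTop.Build d T pk_prod_lex1.

Fact pk_prod_negIU f g :
  f `&` ((fun i => pkneg (f i)) : T) <= g `|` ((fun i => pkneg (g i)) : T).
Proof. by apply/pk_prod_leP => i; apply: pknegIU. Qed.

Fact pk_prod_starP f g : f `&` g = \bot <-> g <= ((fun i => pkstar (f i)) : T).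
Proof.
split=> [fg0 | /pk_prod_leP gf].
  by apply/pk_prod_leP => i; apply/pkstarP; rewrite -[LHS]/((f `&` g) i) fg0.
by apply: pk_prod_ext => i; apply/pkstarP/gf.
Qed.

HB.instance Definition _ := @isPKAlgebra.Build d T
  (fun f i => pkneg (f i)) (fun f i => pkstar (f i))
  (fun f => pk_prod_ext (fun i => pknegK (f i)))
  (fun f g => pk_prod_ext (fun i => pknegI (f i) (g i)))
  pk_prod_negIU pk_prod_starP.

Lemma pk_prod_variety (V : pkAlgebraType d -> Prop) :
  is_variety V -> (forall i, V (A i)) -> V T.
Proof.
move=> [_ _ clP] VA; apply: (clP I A T (fun i f => f i)) => // a.
by exists a; split=> // f fa; apply: pk_prod_ext => i; rewrite fa.
Qed.

End Product.

Record pk_subuniverse d (A : pkAlgebraType d) := PKSubuniverse {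
  subuniv : pred A;
  subuniv_meet : meet_closed subuniv;
  subuniv_join : join_closed subuniv;
  subuniv_bot : \bot \in subuniv;
  subuniv_top : \top \in subuniv;
  subuniv_neg : forall x, x \in subuniv -> pkneg x \in subuniv;
  subuniv_star : forall x, x \in subuniv -> pkstar x \in subuniv
}.

Record pk_sub d (A : pkAlgebraType d) (S : pk_subuniverse A) : Type :=
  PKSub { pk_sub_val : A; pk_sub_valP : pk_sub_val \in subuniv S }.

Section Subalgebra.
Context d (A : pkAlgebraType d) (S : pk_subuniverse A).
Notation T := (pk_sub S).
Implicit Types x y : T.

HB.instance Definition _ := [isSub for @pk_sub_val d A S].
HB.instance Definition _ := [Choice of T by <:].
HB.instance Definition _ := Order.SubChoice_isTBSubLattice.Build _ A _ d T
  (@subuniv_meet _ _ S) (@subuniv_join _ _ S) (@subuniv_bot _ _ S) (@subuniv_top _ _ S).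

Fact pk_sub_meetUl : @left_distributive T T Order.meet Order.join.
Proof. by move=> x y z; apply: val_inj; rewrite /= meetUl. Qed.

HB.instance Definition _ := Order.Lattice_Meet_isDistrLattice.Build d T pk_sub_meetUl.

Definition pk_sub_neg x : T := PKSub (subuniv_neg (pk_sub_valP x)).
Definition pk_sub_star x : T := PKSub (subuniv_star (pk_sub_valP x)).

Fact pk_sub_negK x : pk_sub_neg (pk_sub_neg x) = x.
Proof. by apply: val_inj; apply: pknegK. Qed.
Fact pk_sub_negI x y : pk_sub_neg (x `&` y) = pk_sub_neg x `|` pk_sub_neg y.
Proof. by apply: val_inj; apply: pknegI. Qed.
Fact pk_sub_negIU x y : x `&` pk_sub_neg x <= y `|` pk_sub_neg y.
Proof. exact: (pknegIU (val x) (val y)). Qed.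
Fact pk_sub_starP x y : x `&` y = \bot <-> y <= pk_sub_star x.
Proof.
split=> [/(congr1 val) xy0 | yx]; first exact/(pkstarP (val x) (val y)).
by apply: val_inj; apply/(pkstarP (val x) (val y)).
Qed.

HB.instance Definition _ :=
  isPKAlgebra.Build d T pk_sub_negK pk_sub_negI pk_sub_negIU pk_sub_starP.

Lemma pk_sub_variety (V : pkAlgebraType d -> Prop) : is_variety V -> V A -> V T.
Proof.
by case=> _ clS _; apply: (clS A T (@pk_sub_val d A S)); [split | apply: val_inj].
Qed.

End Subalgebra.

(** * Membership in a variety by finite approximation *)

(** Agreement with [pkstar] is demanded on [Z] only, because a map given by finitely many
  prime filters cannot respect [pkstar] everywhere. *)
Record pk_partial_morphism d (A B : pkAlgebraType d) (Z : seq A) (f : A -> B) : Prop :=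
  PKPartialMorphism {
  pk_partialI : {morph f : x y / x `&` y};
  pk_partialU : {morph f : x y / x `|` y};
  pk_partial0 : f \bot = \bot;
  pk_partial1 : f \top = \top;
  pk_partialN : {morph f : x / pkneg x};
  pk_partialS : {in Z, {morph f : x / pkstar x}}
}.

Section LocalEmbedding.
Context d (L : pkAlgebraType d) (V : pkAlgebraType d -> Prop).

Definition locally_embeds := forall (Z : seq L) (s t : L), s <> t ->
  exists (A : pkAlgebraType d) (e : L -> A),
    [/\ V A, pk_partial_morphism Z e & e s <> e t].

Hypotheses (varV : is_variety V) (embL : locally_embeds).

(** Indexing the product by tasks, and not by maps to members of [V], keeps the index
  type small. *)
Record separation_task := SeparationTask {
  task_set : seq L; task_l : L; task_r : L; task_neq : task_l <> task_r }.

Let task_alg (k : separation_task) : pkAlgebraType d :=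
  sval (cid (embL (task_set k) (@task_neq k))).

Let task_map k : L -> task_alg k :=
  sval (cid (svalP (cid (embL (task_set k) (@task_neq k))))).

Let task_mapP k : [/\ V (task_alg k), pk_partial_morphism (task_set k) (task_map k)
  & task_map k (task_l k) <> task_map k (task_r k)].
Proof. exact: (svalP (cid (svalP (cid (embL (task_set k) (@task_neq k)))))). Qed.

Notation P := (pk_prod task_alg).

Let eventually (f : P) (x : L) :=
  exists Z : seq L, forall k, {subset Z <= task_set k} -> f k = task_map k x.

Let eventually_fun f x y : eventually f x -> eventually f y -> x = y.
Proof.
move=> [Z fx] [Z' fy]; case: (pselect (x = y)) => // xy; exfalso.
pose k := SeparationTask (Z ++ Z') xy; have [_ _ []] := task_mapP k.
by rewrite -(fx k) ?(fy k) // => z zZ; rewrite mem_cat zZ ?orbT.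
Qed.

Let eventually_map x : eventually (task_map^~ x) x.
Proof. by exists [::]. Qed.

Let eventually2 (op : forall A : pkAlgebraType d, A -> A -> A) f g x y :
    (forall k, {morph task_map k : u v / op _ u v}) ->
  eventually f x -> eventually g y -> eventually (fun k => op _ (f k) (g k)) (op _ x y).
Proof.
move=> opM [Z fx] [Z' gy]; exists (Z ++ Z') => k ZZ'; rewrite opM fx ?gy //.
  by move=> z zZ; apply: ZZ'; rewrite mem_cat zZ orbT.
by move=> z zZ; apply: ZZ'; rewrite mem_cat zZ.
Qed.

Let eventuallyI f g x y :
  eventually f x -> eventually g y -> eventually (f `&` g) (x `&` y).
Proof.
by apply: (@eventually2 (fun A => @Order.meet d A)) => k; case: (task_mapP k) => _ [].
Qed.

Let eventuallyU f g x y :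
  eventually f x -> eventually g y -> eventually (f `|` g) (x `|` y).
Proof.
by apply: (@eventually2 (fun A => @Order.join d A)) => k; case: (task_mapP k) => _ [].
Qed.

Let eventually0 : eventually \bot \bot.
Proof. by exists [::] => k _; case: (task_mapP k) => _ [] _ _ ->. Qed.

Let eventually1 : eventually \top \top.
Proof. by exists [::] => k _; case: (task_mapP k) => _ [] _ _ _ ->. Qed.

Let eventuallyN f x : eventually f x -> eventually (pkneg f) (pkneg x).
Proof.
move=> [Z fx]; exists Z => k /fx fkx; have [_ e _] := task_mapP k.
by rewrite (pk_partialN e) -fkx.
Qed.

Let eventuallyS f x : eventually f x -> eventually (pkstar f) (pkstar x).
Proof.
move=> [Z fx]; exists (x :: Z) => k xZ; have [_ e _] := task_mapP k.
rewrite (pk_partialS e) ?xZ ?mem_head // -fx // => z zZ.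
by apply: xZ; rewrite inE zZ orbT.
Qed.

Let good (f : P) := `[< exists x, eventually f x >].

Let goodI : meet_closed good.
Proof.
move=> f g /asboolP[x fx] /asboolP[y gy]; apply/asboolP.
by exists (x `&` y); apply: eventuallyI.
Qed.

Let goodU : join_closed good.
Proof.
move=> f g /asboolP[x fx] /asboolP[y gy]; apply/asboolP.
by exists (x `|` y); apply: eventuallyU.
Qed.

Let good0 : \bot \in good.
Proof. by apply/asboolP; exists \bot. Qed.

Let good1 : \top \in good.
Proof. by apply/asboolP; exists \top. Qed.

Let goodN f : f \in good -> pkneg f \in good.
Proof. by move=> /asboolP[x fx]; apply/asboolP; exists (pkneg x); apply: eventuallyN. Qed.

Let goodS f : f \in good -> pkstar f \in good.
Proof. by move=> /asboolP[x fx]; apply/asboolP; exists (pkstar x); apply: eventuallyS. Qed.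

Let S := PKSubuniverse goodI goodU good0 good1 goodN goodS.
Let E := pk_sub S.

Let limit (f : E) : L := sval (cid (asboolW (pk_sub_valP f))).

Let limitP (f : E) : eventually (val f) (limit f).
Proof. exact: (svalP (cid (asboolW (pk_sub_valP f)))). Qed.

Let limitE f x : eventually (val f) x -> limit f = x.
Proof. exact/eventually_fun/limitP. Qed.

(** A family over the separation tasks is good if from some finite [Z] on it is the
  image of one element of [L].  Good families form a subalgebra of the product: the
  pseudocomplement of a family following [x] follows [pkstar x] once [x] is in [Z].
  The element that a good family follows is unique, since every two distinct elements
  are separated in arbitrarily late coordinates, so [L] is a quotient of that
  subalgebra. *)
Lemma local_embedding : V L.
Proof.
have VE : V E.
  apply: pk_sub_variety => //; apply: pk_prod_variety => // k.
  by have [] := task_mapP k.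
case: varV => clH _ _; apply: (clH E L limit) => // [|x].
  split=> [f g|f g|||f|f]; apply: limitE.
  - by apply: eventuallyI; apply: limitP.
  - by apply: eventuallyU; apply: limitP.
  - exact: eventually0.
  - exact: eventually1.
  - by apply: eventuallyN; apply: limitP.
  - by apply: eventuallyS; apply: limitP.
have gx : (task_map^~ x : P) \in subuniv S by apply/asboolP; exists x.
by exists (PKSub gx : E); apply/limitE/eventually_map.
Qed.

End LocalEmbedding.

(** * Prime filters *)

Section PrimeFilters.
Context d (L : tbDistrLatticeType d).
Implicit Types (F G P Q : set L) (x y b : L).

Definition lattice_filter F : Prop :=
  [/\ F \top, forall x y, x <= y -> F x -> F y & forall x y, F x -> F y -> F (x `&` y)].

Lemma prime_lattice_filter P : prime_filter P -> lattice_filter P.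
Proof. by case. Qed.

Lemma lattice_filterI F x y : lattice_filter F -> F (x `&` y) <-> F x /\ F y.
Proof.
move=> [_ FS FI]; split=> [Fxy | [Fx Fy]]; last exact: FI.
by split; apply: FS Fxy; [apply: leIl | apply: leIr].
Qed.

Lemma prime_filterI P x y : prime_filter P -> P (x `&` y) <-> P x /\ P y.
Proof. by move/prime_lattice_filter; apply: lattice_filterI. Qed.

Lemma prime_filterU P x y : prime_filter P -> P (x `|` y) <-> P x \/ P y.
Proof.
case=> _ _ PS _ PU; split=> [/PU//|[] Pz]; apply: PS Pz; first exact: leUl.
exact: leUr.
Qed.

Definition adjoin_filter F x : set L := fun z => exists2 p, F p & p `&` x <= z.

Lemma adjoin_filterP F x : lattice_filter F ->
  [/\ lattice_filter (adjoin_filter F x), (F `<=` adjoin_filter F x)%classic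
    & adjoin_filter F x x].
Proof.
move=> [F1 FS FI]; split=> [|p Fp|]; last by exists \top; rewrite ?leIr.
  split=> [|y z yz [p Fp py]|y z [p Fp py] [q Fq qz]].
  - by exists \top; rewrite ?lex1.
  - by exists p => //; apply: le_trans yz.
  - exists (p `&` q); first exact: FI.
    by rewrite -[x in _ `&` x]meetxx meetACA leI2.
by exists p; rewrite ?leIl.
Qed.

(** Zorn's lemma, applied to the sets [X] for which the union of [F] and [X] is a
  filter avoiding [b], so that the empty chain, with union [F], is no exception. *)
Lemma filter_zorn F b : lattice_filter F -> ~ F b ->
  exists G, [/\ lattice_filter G, (F `<=` G)%classic, ~ G b &
    forall H, lattice_filter H -> (G `<=` H)%classic -> ~ H b -> H = G].
Proof.
move=> Ffil Fb.
pose C (X : set L) := lattice_filter (F `|` X)%classic /\ ~ (F `|` X)%classic b.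
have [S SC tot|X [[Xfil Xb] Xmax]] := @Zorn_bigcup L C.
  have [sS|noS] := pselect (exists Y, S Y); last first.
    rewrite /C; suff -> : (F `|` \bigcup_(Y in S) Y = F)%classic by split.
    by apply/seteqP; split=> x; [case=> // -[Y SY]; case: noS; exists Y | left].
  have memU x : (F `|` \bigcup_(Y in S) Y)%classic x ->
      exists2 Y, S Y & (F `|` Y)%classic x.
    by case: sS => Y0 SY0 [Fx | [Y SY Yx]]; [exists Y0 => //; left | exists Y => //; right].
  have inU Y x : S Y -> (F `|` Y)%classic x -> (F `|` \bigcup_(Y in S) Y)%classic x.
    by move=> SY [Fx | Yx]; [left | right; exists Y].
  rewrite /C; split; last by move=> /memU[Y /SC[_]].
  split=> [|x y xy /memU[Y SY Yx]|x y /memU[Y SY Yx] /memU[Z SZ Zy]].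
  - by left; case: Ffil.
  - by apply: (inU Y) => //; case: (SC Y SY) => -[_ FS _] _; apply: FS Yx.
  - have [YZ|ZY] := tot Y Z SY SZ.
      apply: (inU Z) => //; case: (SC Z SZ) => -[_ _ FI] _; apply: FI => //.
      by case: Yx => [Fx | /YZ Zx]; [left | right].
    apply: (inU Y) => //; case: (SC Y SY) => -[_ _ FI] _; apply: FI => //.
    by case: Zy => [Fx | /ZY Zx]; [left | right].
exists (F `|` X)%classic; split=> // H Hfil XH Hb.
have FHE : (F `|` H = H)%classic.
  by apply/seteqP; split=> x; [case=> // Fx; apply: XH; left | right].
apply: contrapT => HX; apply: (Xmax H); last by rewrite /C FHE.
split=> [x Xx | HX']; first by apply: XH; right.
by apply: HX; apply/seteqP; split=> // x /HX'; right.
Qed.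

(** Distributivity makes a filter maximal among those avoiding [b] prime: if neither
  [x] nor [y] is in it, adjoining either of them yields [b], and hence so does
  adjoining their join. *)
Lemma prime_filter_zorn F b : lattice_filter F -> ~ F b ->
  exists G, [/\ prime_filter G, (F `<=` G)%classic, ~ G b &
    forall H, lattice_filter H -> (G `<=` H)%classic -> ~ H b -> H = G].
Proof.
move=> Ffil Fb; have [G [Gfil FG Gb Gmax]] := filter_zorn Ffil Fb.
exists G; split=> //; have [G1 GS GI] := Gfil; split=> //.
  by move=> G0; apply: Gb; apply: GS G0; apply: le0x.
have out z : ~ G z -> adjoin_filter G z b.
  move=> Gz; apply: contrapT => zb; apply: Gz.
  by have [Hfil GH Hz] := adjoin_filterP z Gfil; rewrite -(Gmax _ Hfil GH zb).
move=> x y Gxy; apply: contrapT => /not_orP[/out[p Gp pb] /out[q Gq qb]].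
apply: Gb; apply: GS (GI _ _ (GI _ _ Gp Gq) Gxy).
rewrite meetUr leUx (le_trans _ pb) ?leI2 ?leIl //.
by rewrite (le_trans _ qb) // leI2 // leIr.
Qed.

Lemma prime_filter_separates x y : ~~ (x <= y) ->
  exists P, [/\ prime_filter P, P x & ~ P y].
Proof.
move=> /negP xy; have [|//|P [Pprime xP Py _]] := @prime_filter_zorn (fun z => x <= z) y.
  by split=> [|u v uv /le_trans-> //|u v xu xv]; rewrite ?lex1 // lexI xu xv.
by exists P; split=> //; apply: xP; apply: lexx.
Qed.

Lemma proper_filter_maximal F : lattice_filter F -> ~ F \bot ->
  exists2 Q, maximal_prime_filter Q & (F `<=` Q)%classic.
Proof.
move=> Ffil F0; have [Q [Qprime FQ _ Qmax]] := prime_filter_zorn Ffil F0.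
exists Q => //; split=> // G Gprime QG.
by apply: Qmax => //; [apply: prime_lattice_filter | case: Gprime].
Qed.

Lemma prime_filter_maximal P : prime_filter P ->
  exists2 Q, maximal_prime_filter Q & (P `<=` Q)%classic.
Proof.
by move=> Pp; apply: proper_filter_maximal; [apply: prime_lattice_filter | case: Pp].
Qed.

End PrimeFilters.

Section Pseudocomplement.
Context d (L : pkAlgebraType d).
Implicit Types (P Q : set L) (x y : L).

Lemma pkstar_meet x : x `&` pkstar x = \bot.
Proof. exact/pkstarP. Qed.

Lemma le_pkstar x y : x <= y -> pkstar y <= pkstar x.
Proof.
move=> xy; apply/pkstarP/eqP; rewrite -lex0 -(pkstar_meet y); exact: leI2.
Qed.

Lemma pkstar_bot : pkstar (\bot : L) = \top.
Proof. by apply/eqP; rewrite -le1x; apply/pkstarP; rewrite meet0x. Qed.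

Lemma pkneg_anti x y : x <= y -> pkneg y <= pkneg x.
Proof. by move=> /meet_idPl <-; rewrite pknegI leUr. Qed.

Lemma pknegU x y : pkneg (x `|` y) = pkneg x `&` pkneg y.
Proof. by rewrite -[RHS]pknegK pknegI !pknegK. Qed.

Lemma pkneg_bot : pkneg (\bot : L) = \top.
Proof. by apply/eqP; rewrite -le1x -[\top]pknegK pkneg_anti ?le0x. Qed.

Lemma pkneg_top : pkneg (\top : L) = \bot.
Proof. by rewrite -pkneg_bot pknegK. Qed.

Lemma prime_pkstar P x : prime_filter P -> P x -> P (pkstar x) -> False.
Proof. by case=> _ P0 _ PI _ Px /(PI _ _ Px); rewrite pkstar_meet. Qed.

(** If adjoining [x] to [P] gave an improper filter, some element of [P] would be below
  [pkstar x]. *)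
Lemma not_prime_pkstar P x : prime_filter P -> ~ P (pkstar x) ->
  exists Q, [/\ maximal_prime_filter Q, (P `<=` Q)%classic & Q x].
Proof.
move=> Pprime Px; have [Hfil PH Hx] := adjoin_filterP x (prime_lattice_filter Pprime).
case: Pprime => _ _ PS _ _.
have [[p Pp]|Q Qmax HQ] := proper_filter_maximal Hfil.
  by rewrite lex0 meetC => /eqP/pkstarP/PS/(_ Pp).
by exists Q; split=> //; [apply: subset_trans HQ | apply: HQ].
Qed.

Lemma maximal_pkstar Q x : maximal_prime_filter Q -> Q (pkstar x) <-> ~ Q x.
Proof.
move=> [Qprime Qmax]; split=> [Qs Qx | Qx]; first exact: prime_pkstar Qx Qs.
apply: contrapT => /(not_prime_pkstar Qprime)[R [[Rprime _] QR Rx]].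
by apply: Qx; rewrite -(Qmax R).
Qed.

(** The dual of the Kleene negation: an order-reversing involution of the poset of
  prime filters, along which every point is comparable to its image. *)
Definition pkdual P : set L := fun x => ~ P (pkneg x).

Lemma pkdualK P : pkdual (pkdual P) = P.
Proof.
by apply/seteqP; split=> x; rewrite /pkdual pknegK; [apply: contrapT | move=> Px; apply].
Qed.

Lemma pkdual_neg P x : pkdual P (pkneg x) <-> ~ P x.
Proof. by rewrite /pkdual pknegK. Qed.

Lemma pkdual_anti P Q : (P `<=` Q)%classic -> (pkdual Q `<=` pkdual P)%classic.
Proof. by move=> PQ x; apply/contra_not/PQ. Qed.

Lemma pkdual_antiE P Q : (pkdual Q `<=` P)%classic -> (pkdual P `<=` Q)%classic.
Proof. by move=> /pkdual_anti; rewrite pkdualK. Qed.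

Lemma pkdual_prime P : prime_filter P -> prime_filter (pkdual P).
Proof.
move=> [P1 P0 PS PI PU]; rewrite /pkdual; split=> [|||x y Px Py|x y].
- by rewrite pkneg_top.
- by rewrite pkneg_bot; apply.
- by move=> x y /pkneg_anti yx; apply/contra_not/PS.
- by rewrite pknegI => /PU[].
- rewrite pknegU => Pxy; apply: contrapT => /not_orP[/contrapT Px /contrapT Py].
  by apply: Pxy; apply: PI.
Qed.

(** This is the Kleene inequality: an element [p] of [P] outside [pkdual P] and an
  element [q] of [pkdual P] outside [P] would put [p `&` pkneg p] in [P], and neither
  [q] nor [pkneg q]. *)
Lemma pkdual_comparable P : prime_filter P ->
  (P `<=` pkdual P)%classic \/ (pkdual P `<=` P)%classic.
Proof.
move=> Pprime; have [P1 P0 PS PI PU] := Pprime.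
apply: contrapT => /not_orP[/nonsubset[p [Pp /contrapT Pp']] /nonsubset[q [Pq' Pq]]].
by have [] := PU _ _ (PS _ _ (pknegIU p q) (PI _ _ Pp Pp')).
Qed.

(** Of the two possible inclusions between [Q] and its dual, the other one is an equality
  by maximality. *)
Lemma pkdual_maximal Q : maximal_prime_filter Q -> (pkdual Q `<=` Q)%classic.
Proof.
move=> [Qprime Qmax]; have [|//] := pkdual_comparable Qprime.
by move=> /(Qmax _ (pkdual_prime Qprime)) ->.
Qed.

End Pseudocomplement.

(** * Evaluation at finitely many prime filters *)

Section PkBOf.
Context (d : Order.disp_t) (i m : nat).
Implicit Types (A B : {set 'I_i}) (c : 'I_m.-1.+1).

(** The element with coordinates [A], [c], [B], provided that a nonzero coordinate forces
  the preceding ones to be the top. *)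
Definition pkB_of A c B : pkB d i m :=
  if B != \bot then pkB_upper d m B else
  if c != \bot then pkB_middle d i c else pkB_lower d m A.

Lemma pkB_lo_of A c B : (c != \bot -> A = \top) -> (B != \bot -> A = \top) ->
  pkB_lo (pkB_of A c B) = A.
Proof.
by move=> cA BA; rewrite /pkB_of; case: ifP => [/BA->|_] //; case: ifP => [/cA->|].
Qed.

Lemma pkB_mid_of A c B : (B != \bot -> c = \top) -> pkB_mid (pkB_of A c B) = c.
Proof.
by move=> Bc; rewrite /pkB_of; case: ifP => [/Bc->|_] //; case: eqP => [->|].
Qed.

Lemma pkB_up_of A c B : pkB_up (pkB_of A c B) = B.
Proof.
by rewrite /pkB_of; case: eqP => [->|//]; case: ifP.
Qed.

End PkBOf.

(** An order-preserving map, commuting with the involution, from the poset of prime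
  filters of [pkB d i m] to that of [L]: [Q] is the image of the maximal ones,
  [pkdual (Q _)] that of the minimal ones, and [D] that of the chain in between.  It
  need not be injective. *)
Record pkB_dual_map d (L : pkAlgebraType d) (i m : nat)
    (Q : 'I_i -> set L) (D : 'I_m.-1 -> set L) : Prop := PkBDualMap {
  dual_max : forall a, maximal_prime_filter (Q a);
  dual_min_max : forall a b, (pkdual (Q a) `<=` Q b)%classic;
  dual_mid_prime : forall k, prime_filter (D k);
  dual_mid_mono : forall k l : 'I_m.-1, (k <= l)%N -> (D k `<=` D l)%classic;
  dual_mid_rev : forall k, pkdual (D k) = D (rev_ord k);
  dual_mid_max : forall k a, (D k `<=` Q a)%classic
}.

Section EvaluationMap.
Context d (L : pkAlgebraType d) (i m : nat).
Context (Q : 'I_i -> set L) (D : 'I_m.-1 -> set L).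
Hypothesis QD : pkB_dual_map Q D.
Implicit Types x y : L.

Let lo x : {set 'I_i} := finset (fun a => `[< Q a x >]).
Let up x : {set 'I_i} := finset (fun a => `[< pkdual (Q a) x >]).
Let mid x : {set 'I_m.-1} := finset (fun k => `[< D k x >]).
Let rank x : 'I_m.-1.+1 := inord #|mid x|.

Definition dual_eval x : pkB d i m := pkB_of d (lo x) (rank x) (up x).

Let loP x a : reflect (Q a x) (a \in lo x).
Proof. by rewrite inE; apply: asboolP. Qed.
Let upP x a : reflect (pkdual (Q a) x) (a \in up x).
Proof. by rewrite inE; apply: asboolP. Qed.
Let midP x k : reflect (D k x) (k \in mid x).
Proof. by rewrite inE; apply: asboolP. Qed.

Let Q_prime a : prime_filter (Q a). Proof. by case: (dual_max QD a). Qed.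
Let Q'_prime a : prime_filter (pkdual (Q a)). Proof. exact: pkdual_prime. Qed.
Let D_prime k : prime_filter (D k). Proof. exact: dual_mid_prime QD k. Qed.

Let Q'D a k : (pkdual (Q a) `<=` D k)%classic.
Proof. by apply: pkdual_antiE; rewrite (dual_mid_rev QD); apply: (dual_mid_max QD). Qed.

Let rankE x : rank x = #|mid x| :> nat.
Proof. by rewrite inordK // ltnS -[X in (_ <= X)%N]card_ord max_card. Qed.

Let rank_bot x : rank x != \bot -> exists k, D k x.
Proof.
move=> rx; have : (0 < #|mid x|)%N by rewrite -rankE lt0n.
by case/card_gt0P => k /midP; exists k.
Qed.

Let rank_top x : (forall k, D k x) -> rank x = \top.
Proof.
move=> Dx; apply: val_inj; rewrite /= rankE; rewrite -[RHS](card_ord m.-1).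
by apply: eq_card => k; apply/midP.
Qed.

Let up_bot x : up x != \bot -> exists a, pkdual (Q a) x.
Proof. by case/finset.set0Pn => a /upP; exists a. Qed.

Let lo_top x : (forall a, Q a x) -> lo x = \top.
Proof. by move=> Qx; apply/finset.setP => a; rewrite finset.in_setT; apply/loP. Qed.

Let lo_eval x : pkB_lo (dual_eval x) = lo x.
Proof.
apply: pkB_lo_of => [/rank_bot[k Dx] | /up_bot[a Qx]]; apply: lo_top => b.
  exact: (dual_mid_max QD) Dx.
exact: (dual_min_max QD) Qx.
Qed.

Let mid_eval x : pkB_mid (dual_eval x) = rank x.
Proof. by apply: pkB_mid_of => /up_bot[a Qx]; apply: rank_top => k; apply: Q'D Qx. Qed.

Let up_eval x : pkB_up (dual_eval x) = up x.
Proof. exact: pkB_up_of. Qed.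

Let evalE := (lo_eval, mid_eval, up_eval).

Let mid_chain x y : (mid x \subset mid y) || (mid y \subset mid x).
Proof.
apply/orP; have [|/fintype.subsetPn[k kx ky]] := boolP (mid x \subset mid y); first by left.
right; apply/fintype.subsetP => l /midP Dly; apply/midP.
have [kl|/ltnW lk] := leqP k l; first by apply: (dual_mid_mono QD kl); apply/midP.
by case/midP: ky; apply: (dual_mid_mono QD lk).
Qed.

Let rank_le x y : mid x \subset mid y -> rank x <= rank y.
Proof. by move=> /subset_leq_card; rewrite -!rankE. Qed.

Let midI x y : mid (x `&` y) = mid x :&: mid y.
Proof.
apply/finset.setP => k; rewrite finset.in_setI; apply/midP/andP => [|[/midP Dx /midP Dy]].
  by move/(prime_filterI _ _ (D_prime k)) => [/midP-> /midP->].
exact/prime_filterI.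
Qed.

Let midU x y : mid (x `|` y) = mid x :|: mid y.
Proof.
apply/finset.setP => k; rewrite finset.in_setU; apply/midP/orP.
  by move/(prime_filterU _ _ (D_prime k)) => [/midP|/midP]; [left | right].
by case=> /midP Dk; apply/prime_filterU => //; [left | right].
Qed.

Let rankI x y : rank (x `&` y) = rank x `&` rank y.
Proof.
rewrite /rank midI; case/orP: (mid_chain x y) => xy.
  by rewrite (finset.setIidPl xy); apply/esym/meet_idPl/rank_le.
by rewrite (finset.setIidPr xy); apply/esym/meet_idPr/rank_le.
Qed.

Let rankU x y : rank (x `|` y) = rank x `|` rank y.
Proof.
rewrite /rank midU; case/orP: (mid_chain x y) => xy.
  by rewrite (finset.setUidPr xy); rewrite [RHS]join_r ?rank_le.
by rewrite (finset.setUidPl xy); rewrite [RHS]join_l ?rank_le.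
Qed.

Let rankN x : rank (pkneg x) = rev_ord (rank x).
Proof.
apply: val_inj; rewrite /= !rankE subSS.
have -> : mid (pkneg x) = ~: (@rev_ord _ @^-1: mid x).
  apply/finset.setP => k; rewrite !inE -asbool_neg; apply: asbool_equiv_eq.
  by rewrite -(dual_mid_rev QD k) /pkdual; split=> [? //|/contrapT].
by rewrite cardsCs finset.setCK card_ord card_preimset //; apply: rev_ord_inj.
Qed.

(** The inclusions between the filters of [Q] and [D] make the three coordinates of [x]
  compatible, and primality gives the lattice operations.  In [pkB d i m] a nonzero
  element has its pseudocomplement in the lower copy, which matches the fact that
  [pkstar x] avoids every filter below some [Q a] containing [x]; if no [Q a] contains
  [x], then [x] evaluates to zero and [pkstar x] has to be in all the filters, which is
  what the hypothesis on [Z] provides. *)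
Lemma dual_eval_partial (Z : seq L) : (0 < i)%N ->
  (forall x, x \in Z -> (forall a, ~ Q a x) -> forall a, pkdual (Q a) (pkstar x)) ->
  pk_partial_morphism Z dual_eval.
Proof.
move=> i_gt0 starZ; split=> [x y|x y|||x|x xZ].
- apply: pkB_ext; rewrite ?(pkB_loI, pkB_midI, pkB_upI) !evalE //.
    apply/finset.setP => a; rewrite finset.in_setI; apply/loP/andP => [|[/loP ax /loP ay]].
      by move/(prime_filterI _ _ (Q_prime a)) => [/loP-> /loP->].
    exact/prime_filterI.
  apply/finset.setP => a; rewrite finset.in_setI; apply/upP/andP => [|[/upP ax /upP ay]].
    by move/(prime_filterI _ _ (Q'_prime a)) => [/upP-> /upP->].
  exact/prime_filterI.
- apply: pkB_ext; rewrite ?(pkB_loU, pkB_midU, pkB_upU) !evalE //.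
    apply/finset.setP => a; rewrite finset.in_setU; apply/loP/orP.
      by move/(prime_filterU _ _ (Q_prime a)) => [/loP|/loP]; [left | right].
    by case=> /loP ax; apply/prime_filterU => //; [left | right].
  apply/finset.setP => a; rewrite finset.in_setU; apply/upP/orP.
    by move/(prime_filterU _ _ (Q'_prime a)) => [/upP|/upP]; [left | right].
  by case=> /upP ax; apply/prime_filterU => //; [left | right].
- apply: pkB_ext; rewrite evalE.
  + by apply/finset.setP => a; rewrite finset.in_set0; apply/loP; case: (Q_prime a).
  + apply: contrapT => /eqP/rank_bot[k]; by case: (D_prime k).
  + by apply/finset.setP => a; rewrite finset.in_set0; apply/upP; case: (Q'_prime a).
- apply: pkB_ext; rewrite evalE.
  + by apply/lo_top => a; case: (Q_prime a).
  + by apply: rank_top => k; case: (D_prime k).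
  + by apply/finset.setP => a; rewrite finset.in_setT; apply/upP; case: (Q'_prime a).
- apply: pkB_ext; rewrite ?(pkB_lo_neg, pkB_mid_neg, pkB_up_neg) !evalE //.
    by apply/finset.setP => a; rewrite finset.in_setC !inE -asbool_neg; apply: asbool_equiv_eq;
       rewrite /pkdual; split=> [? //|/contrapT].
  apply/finset.setP => a; rewrite finset.in_setC !inE -asbool_neg; apply: asbool_equiv_eq.
  exact: pkdual_neg.
rewrite [RHS]/pkstar /=/pkB_star.
have [[a0 Qx]|noQ] := pselect (exists a, Q a x).
  have noQ' : ~ Q a0 (pkstar x) by move=> /(maximal_pkstar _ (dual_max QD a0)).
  case: eqP => [x0|_].
    have : a0 \in lo x by apply/loP.
    by rewrite -lo_eval x0 finset.in_set0.
  apply: pkB_ext; rewrite evalE.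
  + apply/finset.setP => a; rewrite finset.in_setC lo_eval !inE -asbool_neg.
    by apply: asbool_equiv_eq; apply: (maximal_pkstar _ (dual_max QD a)).
  + by apply: contrapT => /eqP/rank_bot[k /(dual_mid_max QD a0)].
  + apply/finset.setP => a; rewrite finset.in_set0; apply/upP => /(dual_min_max QD a0).
    by [].
have {}noQ a : ~ Q a x by move=> Qx; apply: noQ; exists a.
pose a0 := Ordinal i_gt0.
have -> : dual_eval x = \bot.
  apply: pkB_ext; rewrite evalE.
  + by apply/finset.setP => a; rewrite finset.in_set0; apply/loP/noQ.
  + by apply: contrapT => /eqP/rank_bot[k /(dual_mid_max QD a0)/noQ].
  + by apply/finset.setP => a; rewrite finset.in_set0; apply/upP => /(dual_min_max QD a0)/noQ.
rewrite eqxx; have Qs := starZ x xZ noQ.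
apply: pkB_ext; rewrite evalE.
+ by apply: lo_top => a; apply/(dual_min_max QD a)/(Qs a).
+ by apply: rank_top => k; apply: (@Q'D a0).
+ by apply/finset.setP => a; rewrite finset.in_setT; apply/upP/Qs.
Qed.

(** In the middle coordinate, the sets of indices of filters containing [s] and [t] are
  nested, so they have the same cardinality only if they are equal. *)
Lemma dual_eval_neq s t P :
    (exists a, Q a = P) \/ (exists k, D k = P) -> P s -> ~ P t ->
  dual_eval s <> dual_eval t.
Proof.
move=> [[a <-]|[k <-]] Ps Pt /[dup] st.
  by move=> /(congr1 (@pkB_lo _ _ _)); rewrite !lo_eval => /setP/(_ a);
     move/loP: Ps => ->; move/loP/negPf: Pt => ->.
move=> /(congr1 (@pkB_mid _ _ _)); rewrite !mid_eval => /(congr1 (@nat_of_ord _)).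
rewrite !rankE => eqc; have ks : k \in mid s by apply/midP.
have /midP kt := Pt.
have ts : mid t \subset mid s.
  case/orP: (mid_chain s t) => // /fintype.subsetP/(_ k ks); by rewrite (negPf kt).
have /eqP mE : mid t == mid s by rewrite eqEcard ts eqc leqnn.
by rewrite mE ks in kt.
Qed.

End EvaluationMap.

(** * The identities in terms of prime filters *)

Lemma proper_filter_not_maximal d (L : tbDistrLatticeType d) (P Q : set L) :
    prime_filter P -> ~ maximal_prime_filter P -> maximal_prime_filter Q ->
  (P `<=` Q)%classic -> exists2 x, Q x & ~ P x.
Proof.
move=> Pprime Pmax Qmax PQ; have [QP|/nonsubset[x [Qx Px]]] := pselect (Q `<=` P)%classic.
  by case: Pmax; rewrite (_ : P = Q) //; apply/seteqP.
by exists x.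
Qed.

Section GammaInFilters.
Context d (L : pkAlgebraType d).
Implicit Types (P Q R : set L) (x y : L).

Lemma maximal_pkC Q x : maximal_prime_filter Q -> Q (pkC x).
Proof.
move=> Qmax; have [Qprime _] := Qmax; apply/(prime_filterU _ _ Qprime).
have [Qz|Qz] := pselect (Q (x `&` pkneg x)); first by left.
by right; apply/maximal_pkstar.
Qed.

Lemma prime_pkC P x : prime_filter P -> P x -> P (pkneg x) -> P (pkC x).
Proof. by move=> Pp Px Px'; apply/(prime_filterU _ _ Pp); left; apply/prime_filterI. Qed.

Lemma not_prime_pkC P Q x : prime_filter P -> maximal_prime_filter Q ->
  (P `<=` Q)%classic -> Q x -> Q (pkneg x) -> ~ (P x /\ P (pkneg x)) -> ~ P (pkC x).
Proof.
move=> Pprime [Qprime _] PQ Qx Qx' Px /(prime_filterU _ _ Pprime)[|/PQ].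
  by move/(prime_filterI _ _ Pprime).
by apply: (prime_pkstar Qprime); apply/prime_filterI.
Qed.

(** The filter [Q] contains [pkC x] but not [pkT x], hence it does not contain
  [pkneg (pkC x)]. *)
Lemma prime_pkT_star P Q x : prime_filter P -> maximal_prime_filter Q ->
  (P `<=` Q)%classic -> P (pkstar (pkT x)) -> pkdual Q (pkC x).
Proof.
move=> Pprime Qmax PQ /PQ QT QC; have [Qprime _] := Qmax.
by apply: (prime_pkstar Qprime) QT; apply/prime_filterI => //; split=> //; apply: maximal_pkC.
Qed.

(** If [P] is below its dual, any [y] in a maximal [Q] above [P] but outside [pkdual Q]
  will do; otherwise any [y] in such a [Q] but outside [P]. *)
Lemma not_maximal_pkC P : prime_filter P -> ~ maximal_prime_filter P ->
  exists y, ~ P (pkC y).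
Proof.
move=> Pprime Pmax; have [Q Qmax PQ] := prime_filter_maximal Pprime.
have [Qprime _] := Qmax; have [PP'|P'P] := pkdual_comparable Pprime.
  have Q'max : ~ maximal_prime_filter (pkdual Q).
    move=> [Q'prime Q'max]; apply: Pmax; rewrite -[P]pkdualK.
    have -> : pkdual P = pkdual Q by apply: Q'max; [apply: pkdual_prime | apply: pkdual_anti].
    by rewrite pkdualK.
  have [y Qy Q'y] := proper_filter_not_maximal (pkdual_prime Qprime) Q'max Qmax
    (pkdual_maximal Qmax).
  exists y; apply: (not_prime_pkC Pprime Qmax PQ Qy (contrapT Q'y)) => -[Py Py'].
  exact: (PP' _ Py).
have [y Qy Py] := proper_filter_not_maximal Pprime Pmax Qmax PQ.
exists y; apply: (not_prime_pkC Pprime Qmax PQ Qy) => [|[]//].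
by apply: contrapT => /(pkdual_anti PQ)/P'P.
Qed.

Definition bundle_identity := forall x y : L, pkstar x `&` pkgamma x y = pkstar x.

Definition symmetric_gamma := forall x y : L, pkgamma y x = pkgamma x y.

Definition no_middle_identity :=
  forall x : L, pkC x `&` pkneg (pkC x) = pkneg (pkC x).

(** Both [pkC x] and, by symmetry, [pkgamma x y] are above [pkstar (x `&` pkneg x)], which
  is above [pkstar x]. *)
Lemma symmetric_gamma_bundle : symmetric_gamma -> bundle_identity.
Proof.
move=> sym x y; apply/meet_idPl; rewrite -sym; apply: le_trans (leUr _ _).
by apply: le_trans (leUr _ _); apply/le_pkstar/leIl.
Qed.

(** If [P] is below its dual, take a maximal [Q] above [pkdual P] and [x] in [Q] outside
  [pkdual P].  Then neither [P] nor [pkdual P] contains [pkC x], so [P] contains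
  [pkneg (pkC x)] but not [pkC x]. *)
Lemma no_middle_identity_filter P : no_middle_identity ->
    prime_filter P -> ~ maximal_prime_filter (pkdual P) ->
  ~ (P `<=` pkdual P)%classic.
Proof.
move=> eqC Pprime P'max PP'; have P'prime := pkdual_prime Pprime.
have [Q Qmax P'Q] := prime_filter_maximal P'prime.
have [x Qx P'x] := proper_filter_not_maximal P'prime P'max Qmax P'Q.
have PQ := subset_trans PP' P'Q.
have Qx' : Q (pkneg x).
  by apply: contrapT => Qx'; apply/P'x/PP'/(pkdual_antiE P'Q).
have PCx : ~ P (pkC x).
  by apply: (not_prime_pkC Pprime Qmax PQ Qx Qx') => -[/PP'].
have /contrapT PC'x : ~ pkdual P (pkC x).
  by apply: (not_prime_pkC P'prime Qmax P'Q Qx Qx') => -[].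
by apply: PCx; move: PC'x; rewrite -eqC => /(prime_filterI _ _ Pprime)[].
Qed.

(** If [P] is strictly below [pkdual P], and this is strictly below a maximal [Q], pick
  [x] in [pkdual P] but not in [P], and [y] in [Q] but not in [pkdual P].  Then
  [pkdual P] contains [pkC x], but neither [pkC y] nor [pkstar (pkT x)], so it contains
  [pkgamma y x] but not [pkgamma x y]. *)
Lemma symmetric_gamma_filter P : symmetric_gamma ->
    prime_filter P -> ~ maximal_prime_filter (pkdual P) ->
  (P `<=` pkdual P)%classic -> pkdual P = P.
Proof.
move=> sym Pprime P'max PP'; have P'prime := pkdual_prime Pprime.
apply/seteqP; split=> //; apply: contrapT => /nonsubset[x [P'x Px]].
have [Q Qmax P'Q] := prime_filter_maximal P'prime; have [Qprime _] := Qmax.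
have [y Qy P'y] := proper_filter_not_maximal P'prime P'max Qmax P'Q.
have Q'P := pkdual_antiE P'Q.
have : pkdual P (pkgamma y x).
  apply/(prime_filterU _ _ P'prime); right; apply: (prime_pkC P'prime P'x).
  exact/pkdual_neg.
rewrite sym => /(prime_filterU _ _ P'prime)[/(prime_pkT_star P'prime Qmax P'Q)|].
  apply: (not_prime_pkC (pkdual_prime Qprime) Qmax (pkdual_maximal Qmax) (P'Q _ P'x)).
    by apply: contrapT => /Q'P.
  by case=> /Q'P.
apply: (not_prime_pkC P'prime Qmax P'Q Qy); last by case.
by apply: contrapT => /Q'P/PP'.
Qed.

(** For [p] in [P] outside [R], put [x = pkstar p], so that [P] contains [pkstar x] and
  therefore [pkgamma x y] for all [y].  As some [pkC y] is not in [P], this filter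
  contains [pkstar (pkT x)], hence [pkdual Q] contains [pkC x].  This is not possible,
  because [R] contains [x] and [pkneg x], and [pkdual Q] does not contain [x]. *)
Lemma bundle_identity_filter P Q R : bundle_identity ->
    prime_filter P -> ~ maximal_prime_filter P ->
    maximal_prime_filter Q -> (P `<=` Q)%classic ->
    maximal_prime_filter R -> (pkdual Q `<=` R)%classic -> (P `<=` R)%classic.
Proof.
move=> eqG Pprime Pmax Qmax PQ Rmax Q'R.
apply: contrapT => /nonsubset[p [Pp /(maximal_pkstar _ Rmax) Rx]].
set x := pkstar p in Rx; have Qp := PQ _ Pp; have [Qprime _] := Qmax.
have Qx : ~ Q x by move/(maximal_pkstar _ Qmax).
have [y PCy] := not_maximal_pkC Pprime Pmax.
have : P (pkstar x).
  case: Pprime => _ _ PS _ _; apply: PS Pp.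
  by apply/pkstarP; rewrite meetC; apply: pkstar_meet.
rewrite -(eqG x y) => /(prime_filterI _ _ Pprime)[_ /(prime_filterU _ _ Pprime)[]//].
move=> /(prime_pkT_star Pprime Qmax PQ).
apply: (not_prime_pkC (pkdual_prime Qprime) Rmax Q'R Rx).
  by apply: contrapT => /(pkdual_antiE Q'R).
by case=> /(pkdual_maximal Qmax).
Qed.

End GammaInFilters.

(** Under the bundle identity this is an equivalence relation on the maximal prime
  filters. *)
Definition cluster d (L : pkAlgebraType d) (Q : set L) : set (set L) :=
  fun R => maximal_prime_filter R /\ (pkdual Q `<=` R)%classic.

Section Cluster.
Context d (L : pkAlgebraType d).
Implicit Types (P Q R : set L) (x y : L).

Lemma cluster_refl Q : maximal_prime_filter Q -> cluster Q Q.
Proof. by move=> Qmax; split=> //; apply: pkdual_maximal. Qed.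

Lemma cluster_sym Q R : maximal_prime_filter Q -> cluster Q R -> cluster R Q.
Proof. by move=> Qmax [_ QR]; split=> //; apply: pkdual_antiE. Qed.

Lemma cluster_trans Q R S : bundle_identity L -> maximal_prime_filter Q ->
  cluster Q R -> cluster R S -> cluster Q S.
Proof.
move=> eqG Qmax [Rmax Q'R] [Smax R'S]; split=> //.
have [Qprime _] := Qmax; have Q'prime := pkdual_prime Qprime.
have [Q'max|Q'max] := pselect (maximal_prime_filter (pkdual Q)).
  case: Q'max => _ Q'max; have QQ' := Q'max Q Qprime (pkdual_maximal Qmax).
  by have [Rprime _] := Rmax; rewrite QQ' -(Q'max R Rprime Q'R).
exact: bundle_identity_filter Rmax Q'R Smax R'S.
Qed.

Lemma cluster_dual_map i m Q (q : 'I_i -> set L) (D : 'I_m.-1 -> set L) :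
    bundle_identity L -> maximal_prime_filter Q ->
    (forall a, cluster Q (q a)) ->
    (forall k, [/\ prime_filter (D k), ~ maximal_prime_filter (D k)
      & (D k `<=` Q)%classic]) ->
    (forall k l : 'I_m.-1, (k <= l)%N -> (D k `<=` D l)%classic) ->
    (forall k, pkdual (D k) = D (rev_ord k)) ->
  pkB_dual_map q D.
Proof.
move=> eqG Qmax qQ DP Dmono Drev; split=> // [a|a b|k|k a]; first by case: (qQ a).
- have [qa_max _] := qQ a.
  by have [] := cluster_trans eqG qa_max (cluster_sym Qmax (qQ a)) (qQ b).
- by case: (DP k).
- have [Dprime Dmax DQ] := DP k; have [qa_max Qqa] := qQ a.
  exact: bundle_identity_filter Dprime Dmax Qmax DQ qa_max Qqa.
Qed.

(** If [pkstar x] is not in the dual of [q a], some maximal filter above that dual contains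
  [x]; it is again in the cluster of [Q], so [x] is in one of the chosen filters. *)
Lemma cluster_star i Q (q : 'I_i -> set L) x :
    bundle_identity L -> maximal_prime_filter Q ->
    (forall a, cluster Q (q a)) ->
    ((exists2 R, cluster Q R & R x) -> exists a, q a x) ->
  (forall a, ~ q a x) -> forall a, pkdual (q a) (pkstar x).
Proof.
move=> eqG Qmax qQ cov qx a; have [[qa_prime _] _] := qQ a.
apply: contrapT => /(not_prime_pkstar (pkdual_prime qa_prime))[R [Rmax qR Rx]].
have [|b qbx] := cov; last exact: qx qbx.
by exists R => //; apply: cluster_trans (qQ a) _.
Qed.

(** The [i] filters chosen in the cluster of [Q] may be repeated, and only those elements
  of [Z] count that belong to some filter of the cluster: this is what evaluation at
  the chosen filters requires in order to respect [pkstar] on [Z]. *)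
Definition clusters_covered_by (I : nat -> Prop) :=
  forall (Q : set L) (Z : seq L), maximal_prime_filter Q ->
  exists (i : nat) (q : 'I_i -> set L), [/\ I i, forall a, cluster Q (q a),
    exists a, q a = Q &
    forall x, x \in Z -> (exists2 R, cluster Q R & R x) -> exists a, q a x].

(** Every prime filter below its dual and neither minimal nor maximal is, together with its
  dual, the image of the chain of prime filters in the middle of [pkB d i m]. *)
Definition middle_chains (m : nat) := forall P : set L,
  prime_filter P -> ~ maximal_prime_filter P -> ~ maximal_prime_filter (pkdual P) ->
  (P `<=` pkdual P)%classic ->
  exists D : 'I_m.-1 -> set L, [/\ forall k, D k = P \/ D k = pkdual P,
    forall k l : 'I_m.-1, (k <= l)%N -> (D k `<=` D l)%classic,
    forall k, pkdual (D k) = D (rev_ord k),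
    exists k, D k = P & exists k, D k = pkdual P].

(** It is enough to separate [s] from [t] when a prime filter [P] contains [s] but not [t].
  If [P] or its dual is maximal, evaluation at filters in its cluster does it, with
  values in [pkB d i 1].  Otherwise, a maximal [Q] above both [P] and its dual provides
  the cluster, and the middle chain through [P] separates. *)
Lemma bundle_identity_variety (V : pkAlgebraType d -> Prop) (I : nat -> Prop) m :
    is_variety V ->
    (forall i, I i -> [/\ (0 < i)%N, V (pkB d i 1) & V (pkB d i m)]) ->
    bundle_identity L -> clusters_covered_by I -> middle_chains m -> V L.
Proof.
move=> varV VI eqG cov mid; apply: local_embedding => // Z.
suff sep s t : ~~ (s <= t) -> exists (A : pkAlgebraType d) (e : L -> A),
    [/\ V A, pk_partial_morphism Z e & e s <> e t].
  move=> s t st; have [st'|/sep//] := boolP (s <= t).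
  have [ts|/sep[A [e [VA eZ ets]]]] := boolP (t <= s).
    by case: st; apply: le_anti; rewrite st' ts.
  by exists A, e; split=> // /esym.
move=> /prime_filter_separates[P [Pprime Ps Pt]].
have extreme Q s' t' : maximal_prime_filter Q -> Q s' -> ~ Q t' ->
    exists (A : pkAlgebraType d) (e : L -> A),
    [/\ V A, pk_partial_morphism Z e & e s' <> e t'].
  move=> Qmax Qs Qt; have [i [q [Ii qQ qa qZ]]] := cov Q Z Qmax.
  have [i_gt0 V1 _] := VI _ Ii.
  (* The domain of the chain is empty. *)
  pose D (k : 'I_1.-1) : set L := Q.
  have qD : pkB_dual_map q D by apply: (cluster_dual_map (Q := Q)) => // -[].
  exists (pkB d i 1), (dual_eval q D); split=> //.
    apply: (dual_eval_partial qD) => // x xZ.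
    exact: (cluster_star eqG Qmax qQ (qZ x xZ)).
  by apply: (dual_eval_neq qD (P := Q)) => //; left.
have [Pmax|Pmax] := pselect (maximal_prime_filter P); first exact: extreme Pmax Ps Pt.
have [P'max|P'max] := pselect (maximal_prime_filter (pkdual P)).
  have P't : pkdual P (pkneg t) by apply/pkdual_neg.
  have P's : ~ pkdual P (pkneg s) by move/pkdual_neg.
  have [A [e [VA eZ ets]]] := extreme _ _ _ P'max P't P's.
  by exists A, e; split=> // est; apply: ets; rewrite !(pk_partialN eZ) est.
(* Replacing [P] by its dual if needed makes it the lower one of the two. *)
have [P0 [P0P P0prime P0max P0'max P0P0']] : exists P0, [/\ P = P0 \/ P = pkdual P0,
    prime_filter P0, ~ maximal_prime_filter P0, ~ maximal_prime_filter (pkdual P0)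
    & (P0 `<=` pkdual P0)%classic].
  have [PP'|P'P] := pkdual_comparable Pprime; first by exists P; split=> //; left.
  by exists (pkdual P); rewrite pkdualK; split=> //; [right | apply: pkdual_prime].
have P0'prime := pkdual_prime P0prime.
have [Q Qmax P0'Q] := prime_filter_maximal P0'prime.
have [i [q [Ii qQ qa qZ]]] := cov Q Z Qmax; have [i_gt0 _ Vm] := VI _ Ii.
have [D [DP Dmono Drev [k Dk] [l Dl]]] := mid _ P0prime P0max P0'max P0P0'.
have qD : pkB_dual_map q D.
  apply: (cluster_dual_map (Q := Q)) => // j.
  by case: (DP j) => ->; split=> //; apply: subset_trans P0'Q.
exists (pkB d i m), (dual_eval q D); split=> //.
  apply: (dual_eval_partial qD) => // x xZ.
  exact: (cluster_star eqG Qmax qQ (qZ x xZ)).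
by apply: (dual_eval_neq qD (P := P)) => //; right; case: P0P => ->; [exists k | exists l].
Qed.

Lemma clusters_covered_pos : clusters_covered_by (fun i => (0 < i)%N).
Proof.
move=> Q Z Qmax.
have /choice[r rP] x : exists R0 : set L, cluster Q R0 /\
    ((exists2 R, cluster Q R & R x) -> R0 x).
  have [[R QR Rx]|noR] := pselect (exists2 R, cluster Q R & R x); first by exists R.
  by exists Q; split=> //; apply: cluster_refl.
exists (size Z).+1, (fun a => nth Q (Q :: map r Z) a); split=> //.
- case=> -[|a] aZ /=; first exact: cluster_refl.
  by rewrite (nth_map \bot) //; case: (rP (nth \bot Z a)).
- by exists ord0.
move=> x xZ /(proj2 (rP x)) rx; have ix : ((index x Z).+1 < (size Z).+1)%N.
  by rewrite ltnS index_mem.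
by exists (Ordinal ix); rewrite /= (nth_map \bot) ?index_mem // nth_index.
Qed.

Lemma prime_filter_bigmeet P (J : finType) (F : J -> L) : prime_filter P ->
  (forall j, P (F j)) -> P (\meet_j F j).
Proof. by case=> P1 _ _ PI _ PF; elim/big_ind: _. Qed.

Lemma prime_filter_bigjoin P (J : finType) (B : pred J) (F : J -> L) : prime_filter P ->
  P (\join_(j | B j) F j) -> exists2 j, B j & P (F j).
Proof.
case=> _ P0 _ _ PU; elim/big_ind: _ => [/P0//|x y Px Py /PU[/Px|/Py]//|j Bj Pj].
by exists j.
Qed.

(** As long as the values found so far do not exhaust [M], they are extended by a new
  one. *)
Lemma injection_or_enumeration T (M : set T) t0 n : M t0 ->
  (exists q : nat -> T, (forall a, M (q a)) /\
     forall a b, (a < b <= n)%N -> q a <> q b) \/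
  (exists q : nat -> T, (forall a, M (q a)) /\
     forall t, M t -> exists2 a, (a < n)%N & q a = t).
Proof.
move=> Mt0; elim: n => [|n [[q [Mq qI]]|[q [Mq qS]]]].
- by left; exists (fun=> t0); split=> // a b /andP[+]; rewrite leqn0 => + /eqP b0; rewrite b0.
- have [onto|] := pselect (forall t, M t -> exists2 a, (a < n.+1)%N & q a = t).
    by right; exists q.
  move=> /existsNP[t /not_implyP[Mt qt]]; left.
  exists (fun a => if (a == n.+1) then t else q a).
  split=> [a|a b /andP[ab]]; first by case: ifP.
  rewrite leq_eqVlt ltnS; case/orP => [/eqP bn|bn].
    rewrite bn eqxx ltn_eqF -?bn // => qa; apply: qt; exists a => //.
    by rewrite -bn.
  have an : (a < n.+1)%N by rewrite ltnS (leq_trans (ltnW ab)).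
  by rewrite !ltn_eqF //; apply: qI; rewrite ab.
- by right; exists q; split=> // t /qS[a an qa]; exists a => //; apply: leq_trans an _.
Qed.

Definition beta_identity n := forall x : 'I_n -> L, pkbeta x = \top.

(** Suppose that a cluster contains distinct maximal filters [q 0], ..., [q n].  Primality
  gives elements [x j], for [j < n], with [x j] in all of them but [q j].  The meet of
  the [x j] is then in [q n], and replacing [x j] by [pkstar (x j)] gives a meet in
  [q j].  All these filters contain [pkdual Q], which therefore contains none of the
  pseudocomplements joined in [pkbeta x], although it contains their join. *)
Lemma beta_clusters_covered n : beta_identity n -> clusters_covered_by (eq n).
Proof.
move=> eqB Q Z Qmax.
have [[q [qQ qI]]|[q [qQ qS]]] := injection_or_enumeration n (cluster_refl Qmax); last first.
  have [a an qa] := qS Q (cluster_refl Qmax).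
  exists n, (fun a : 'I_n => q a); split=> //; first by exists (Ordinal an).
  by move=> x _ [R /qS[b bn qb] Rx]; exists (Ordinal bn); rewrite /= qb.
exfalso; have [Qprime _] := Qmax.
have qprime a : prime_filter (q a) by case: (qQ a) => -[].
have sep a b : (a <= n)%N -> (b <= n)%N -> a != b -> exists x, q b x /\ ~ q a x.
  move=> an bn ab; apply/nonsubset => qba.
  have qE : q a = q b by case: (qQ b) => -[_ qmax] _; apply: qmax.
  by move: ab; rewrite neq_ltn => /orP[lt|lt];
    [apply: (qI a b) | apply: (qI b a)]; rewrite ?lt //.
have /choice[x xP] (j : 'I_n) : exists x : L,
    ~ q j x /\ forall b, (b <= n)%N -> b != j -> q b x.
  have jn : (j <= n)%N by apply: ltnW.
  have /choice[u uP] (b : 'I_n.+1) : exists u : L, b != j :> nat -> q b u /\ ~ q j u.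
    have [->|bj] := eqVneq (b : nat) j; first by exists \bot.
    have jb : j != b :> nat by rewrite eq_sym.
    by have [u uP] := sep j b jn (ltn_ord b) jb; exists u.
  exists (\join_(b < n.+1 | b != j :> nat) u b); split.
    by move=> /(prime_filter_bigjoin (qprime j))[b /uP[_]].
  move=> b bn bj; have [_ _ qS _ _] := qprime b.
  pose b' := Ordinal (bn : (b < n.+1)%N); have [qub _] := uP b' bj.
  by apply: qS qub; apply: (joins_sup (j := b')).
have Q'q b : (pkdual Q `<=` q b)%classic by case: (qQ b).
have Q'prime := pkdual_prime Qprime.
have : pkdual Q (pkbeta x) by rewrite eqB; case: Q'prime.
move=> /(prime_filterU _ _ Q'prime)[/(Q'q n)|].
  apply: (prime_pkstar (qprime n)); apply: prime_filter_bigmeet => // j.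
  by have [_] := xP j; apply; rewrite ?gtn_eqF.
move=> /(prime_filter_bigjoin Q'prime)[i _ /(Q'q i)].
apply: (prime_pkstar (qprime i)); apply: prime_filter_bigmeet => // j.
have [->|ji] := eqVneq j i.
  by apply/maximal_pkstar; [case: (qQ i) | case: (xP i)].
by have [_] := xP j; apply; rewrite 1?ltnW // eq_sym.
Qed.

Lemma middle_chains1 : no_middle_identity L -> middle_chains 1.
Proof. by move=> eqC P Pprime _ P'max /(no_middle_identity_filter eqC Pprime P'max). Qed.

Lemma middle_chains2 : symmetric_gamma L -> middle_chains 2.
Proof.
move=> sym P Pprime _ P'max /(symmetric_gamma_filter sym Pprime P'max) P'P.
exists (fun=> P); rewrite P'P.
by split=> // [k|||]; [left | move=> k l _ x | exists ord0 | exists ord0].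
Qed.

Lemma middle_chains3 : middle_chains 3.
Proof.
move=> P Pprime _ _ PP'.
exists (fun k => if k == ord0 then P else pkdual P); split.
- by move=> k; case: ifP; [left | right].
- by case=> [[|[|//]]] ? [[|[|//]]] ? //= _ x //; apply: PP'.
- by case=> [[|[|//]]] ? //=; rewrite pkdualK.
- by exists ord0.
- by exists ord_max.
Qed.

End Cluster.

(** * Varieties defined by identities *)

Section Varieties.
Context d (K : pkAlgebraType d -> Prop).

Lemma variety_of_variety : is_variety (variety_of K).
Proof.
split=> [A B f fM fS KA|A B f fM fI KA|I A P p pM pP KA] V varV KV; have [clH clS clP] := varV.
- by apply: clH fM fS _; apply: KA.
- by apply: clS fM fI _; apply: KA.
- by apply: clP pM pP _ => i; apply: KA.
Qed.

Lemma variety_of_gen A : K A -> variety_of K A.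
Proof. by move=> KA V _; apply. Qed.

Lemma variety_of_sub (V : pkAlgebraType d -> Prop) L :
  is_variety V -> (forall A, K A -> V A) -> variety_of K L -> V L.
Proof. by move=> varV KV; apply. Qed.

End Varieties.

Lemma is_variety_iff d (V W : pkAlgebraType d -> Prop) :
  (forall A, W A <-> V A) -> is_variety V -> is_variety W.
Proof.
move=> E [VH VS VP]; split=> [A B f fM fS|A B f fM fI|I A P p pM pP WA].
- by move/E/(VH _ _ _ fM fS)/E.
- by move/E/(VS _ _ _ fM fI)/E.
- by apply/E; apply: VP pM pP _ => i; apply/E.
Qed.

Lemma varietyI d (V W : pkAlgebraType d -> Prop) :
  is_variety V -> is_variety W -> is_variety (fun A => V A /\ W A).
Proof.
move=> [VH VS VP] [WH WS WP]; split=> [A B f fM fS []|A B f fM fI []|I A P p pM pP VW].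
- by move=> /(VH _ _ _ fM fS) VB /(WH _ _ _ fM fS).
- by move=> /(VS _ _ _ fM fI) VB /(WS _ _ _ fM fI).
- by split; [apply: VP pM pP _ | apply: WP pM pP _] => i; case: (VW i).
Qed.

(** Term operations are represented by natural families of functions of a valuation,
  which avoids a syntax of terms. *)
Definition pk_operation d (X : Type) := forall A : pkAlgebraType d, (X -> A) -> A.

Definition pk_natural d (X : Type) (s : pk_operation d X) : Prop :=
  forall (A B : pkAlgebraType d) (f : A -> B), pk_morphism f ->
  forall v : X -> A, f (s A v) = s B (f \o v).

Definition pk_models d (X : Type) (s t : pk_operation d X) (A : pkAlgebraType d) : Prop :=
  forall v : X -> A, s A v = t A v.

Lemma pk_models_variety d (X : Type) (s t : pk_operation d X) :
  pk_natural s -> pk_natural t -> is_variety (pk_models s t).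
Proof.
move=> sN tN; split=> [A B f fM fS stA v|A B f fM fI stA v|I A P p pM pP stA v].
- have [w wv] := choice (fun x => fS (v x)).
  have -> : v = f \o w by apply: functional_extensionality_dep => x; rewrite /= wv.
  by rewrite -(sN _ _ _ fM) -(tN _ _ _ fM) stA.
- by apply: fI; rewrite (sN _ _ _ fM) (tN _ _ _ fM).
- have [x [_ xU]] := pP (fun i => p i (s P v)).
  rewrite -(xU (s P v)) // -(xU (t P v)) // => i.
  by rewrite (sN _ _ _ (pM i)) (tN _ _ _ (pM i)) stA.
Qed.

Section Morphisms.
Context d (A B : pkAlgebraType d) (f : A -> B) (fM : pk_morphism f).

Lemma pk_morph_pkC x : f (pkC x) = pkC (f x).
Proof. by case: fM => fI fU _ _ fN fS; rewrite /pkC fU fS fI fN. Qed.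

Lemma pk_morph_pkgamma x y : f (pkgamma x y) = pkgamma (f x) (f y).
Proof.
by case: fM => fI fU _ _ fN fS; rewrite /pkgamma /pkT fU fS fI fN !pk_morph_pkC.
Qed.

Lemma pk_morph_pkbeta n (x : 'I_n -> A) : f (pkbeta x) = pkbeta (f \o x).
Proof.
case: fM => fI fU f0 f1 fN fS; rewrite /pkbeta fU fS (big_morph f fI f1); congr (_ `|` _).
rewrite (big_morph f fU f0); apply: eq_bigr => i _; rewrite fS; congr (pkstar _).
by rewrite (big_morph f fI f1); apply: eq_bigr => j _; case: ifP => //=.
Qed.

End Morphisms.

Section IdentityVarieties.
Context (d : Order.disp_t).

Lemma bundle_identity_variety_class : is_variety (@bundle_identity d).
Proof.
apply: (is_variety_iff (V := pk_models
    (fun A (v : bool -> A) => pkstar (v true) `&` pkgamma (v true) (v false))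
    (fun A v => pkstar (v true)))) => [A|].
  by split=> [eqA v|eqA x y]; [apply: eqA | apply: (eqA (fun b => if b then x else y))].
apply: pk_models_variety => A B f fM v /=; last by rewrite (pk_morphS fM).
by rewrite (pk_morphI fM) (pk_morphS fM) (pk_morph_pkgamma fM).
Qed.

Lemma symmetric_gamma_variety_class : is_variety (@symmetric_gamma d).
Proof.
apply: (is_variety_iff (V := pk_models
    (fun A (v : bool -> A) => pkgamma (v false) (v true))
    (fun A v => pkgamma (v true) (v false)))) => [A|].
  by split=> [eqA v|eqA x y]; [apply: eqA | apply: (eqA (fun b => if b then x else y))].
by apply: pk_models_variety => A B f fM v /=; rewrite (pk_morph_pkgamma fM).
Qed.

Lemma no_middle_identity_variety_class : is_variety (@no_middle_identity d).
Proof.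
apply: (is_variety_iff (V := pk_models
    (fun A (v : unit -> A) => pkC (v tt) `&` pkneg (pkC (v tt)))
    (fun A v => pkneg (pkC (v tt))))) => [A|].
  by split=> [eqA v|eqA x]; [apply: eqA | apply: (eqA (fun=> x))].
apply: pk_models_variety => A B f fM v /=; rewrite ?(pk_morphI fM) (pk_morphN fM);
  by rewrite (pk_morph_pkC fM).
Qed.

Lemma beta_identity_variety_class n : is_variety (fun A : pkAlgebraType d => beta_identity A n).
Proof.
apply: (pk_models_variety (X := 'I_n) (s := fun A v => pkbeta v) (t := fun A v => \top)).
  by move=> A B f fM v; apply: (pk_morph_pkbeta fM).
by move=> A B f fM v; apply: (pk_morph1 fM).
Qed.

End IdentityVarieties.

(** At a maximal filter [pkC y] is always present.  A non-maximal filter is below all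
  maximal ones, so it contains [pkstar x] only if [x] is in no maximal filter, that is
  [x = \bot], and then [pkgamma x y] is the top. *)
Lemma bundle_satisfies_identity d (L : pkAlgebraType d) : bundle L -> bundle_identity L.
Proof.
move=> bL x y; apply/meet_idPl; apply: contrapT => /negP.
move=> /prime_filter_separates[P [Pprime Px Pg]].
have [Pmax|Pmax] := pselect (maximal_prime_filter P).
  by apply: Pg; apply/(prime_filterU _ _ Pprime); right; apply: maximal_pkC.
have x0 : x = \bot.
  apply/eqP; rewrite -lex0; apply: contrapT => /negP.
  move=> /prime_filter_separates[Q [/prime_filter_maximal[F Fmax QF] Qx _]].
  by apply: (maximal_pkstar x Fmax).1 (QF _ Qx); apply: (bL F P).
apply: Pg; apply/(prime_filterU _ _ Pprime); left.
rewrite /pkT /pkC x0 meet0x pkstar_bot joinx1 pkneg_top meetx0 pkstar_bot.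
by case: Pprime.
Qed.

Section BAlgebras.
Context (d : Order.disp_t) (i : nat) (i_gt0 : (0 < i)%N).

Lemma subset_top_neq0 : (\top : {set 'I_i}) != \bot.
Proof. by apply/finset.set0Pn; exists (Ordinal i_gt0); rewrite finset.in_setT. Qed.

Section AnyMiddle.
Context (m : nat).
Notation A := (pkB d i m).
Implicit Types (x y : A).

Lemma pkB_eq0 x : (x == \bot) = (pkB_lo x == \bot).
Proof.
apply/eqP/eqP => [->//|lx].
have lt : pkB_lo x <> \top by rewrite lx; apply/eqP; rewrite eq_sym subset_top_neq0.
have mx : pkB_mid x = \bot.
  by apply: contrapT => /eqP mx; apply: lt; apply: pkB_lo_eq1; rewrite mx.
apply: pkB_ext => //; apply: contrapT => /eqP ux; apply: lt; apply: pkB_lo_eq1.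
by rewrite ux orbT.
Qed.

Lemma pkB_star_neq0 x : x != \bot -> pkstar x = pkB_lower d m (~` pkB_lo x).
Proof. by rewrite [pkstar x]/pkstar /= /pkB_star => /negPf->. Qed.

Lemma pkB_lower_bot : pkB_lower d m \bot = \bot :> A.
Proof. exact: pkB_ext. Qed.

Let m0 : A := pkB_middle d i (ord0 : 'I_m.-1.+1).

Lemma pkB_bottom_middle_neq0 : m0 != \bot.
Proof. by rewrite pkB_eq0 subset_top_neq0. Qed.

Lemma pkB_bottom_middle_max (F : set A) : maximal_prime_filter F -> F m0.
Proof.
move=> Fmax; apply: contrapT => /(maximal_pkstar _ Fmax).
rewrite (pkB_star_neq0 pkB_bottom_middle_neq0) [~` _]compl1 pkB_lower_bot.
by case: Fmax => -[].
Qed.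

Lemma pkB_dense x : m0 <= x `|` pkstar x.
Proof.
have [->|x0] := eqVneq x \bot; first by rewrite pkstar_bot joinx1 lex1.
rewrite pkB_star_neq0 // pkB_leE pkB_loU [pkB_lo (pkB_lower _ _ _)]/= joinxC lex1 /=.
by rewrite !le0x.
Qed.

Lemma pkB_total_middle x : (x <= m0) || (m0 <= x).
Proof.
by case: (pkBP x) => [a|c|b] ->; rewrite !pkB_leE /= ?lex1 ?le0x ?lexx ?orbT.
Qed.

(** Maximal filters contain the bottom of the middle chain, which is dense.  A prime filter
  with an element that is not above that bottom contains it, hence contains every
  [x `|` pkstar x], and so is maximal. *)
Lemma pkB_bundle : bundle A.
Proof.
move=> F G Fmax Gprime Gmax x Gx; have [[F1 F0 FS FI FU] _] := Fmax.
have /orP[xm|] := pkB_total_middle x; last by move/FS; apply; apply: pkB_bottom_middle_max.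
case: Gmax; have [_ _ GS _ GU] := Gprime; split=> // H Hprime GH.
apply/seteqP; split=> // y Hy; have [//|/GH Hs] := GU _ _ (GS _ _ (pkB_dense y) (GS _ _ xm Gx)).
by have := prime_pkstar Hprime Hy Hs.
Qed.

Lemma pkC_kernel_bot x : x `&` pkneg x = \bot -> pkC x = \top.
Proof. by move=> z0; rewrite /pkC z0 pkstar_bot joinx1. Qed.

Lemma pkC_pkB x : x `&` pkneg x != \bot ->
  pkC x = pkB_middle d i (pkB_mid x `&` rev_ord (pkB_mid x)).
Proof.
move=> z0; rewrite /pkC pkB_star_neq0 //; apply: pkB_ext.
- by rewrite pkB_loU [pkB_lo (pkB_lower _ _ _)]/= joinxC.
- by rewrite pkB_midU pkB_midI joinx0.
- rewrite pkB_upU pkB_upI joinx0 -[pkneg x]/(pkB_neg x) pkB_up_neg.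
  by case: (pkBP x) => [a|c|b] ->; rewrite ?meet0x //= [~` _]compl1 meetx0.
Qed.

End AnyMiddle.
End BAlgebras.

(** * The identities in the algebras B + C + B *)

Section BIdentities.
Context (d : Order.disp_t) (i : nat) (i_gt0 : (0 < i)%N).

Lemma pkB_lo_le m (x y : pkB d i m) (a : 'I_i) : x <= y -> a \in pkB_lo x -> a \in pkB_lo y.
Proof. by rewrite pkB_leE => /andP[/fintype.subsetP xy _]; apply: xy. Qed.

Lemma pkB_atom m (x : pkB d i m) : x <> \bot -> exists a, a \in pkB_lo x.
Proof. by move/eqP; rewrite (pkB_eq0 i_gt0) => /finset.set0Pn. Qed.

(** In [pkB d i 1] the value of [pkC] is the top or the unique middle element, which is
  its own negation. *)
Lemma pkB_no_middle : no_middle_identity (pkB d i 1).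
Proof.
move=> x; apply/meet_idPr.
have [/pkC_kernel_bot->|/pkC_pkB->] := eqVneq (x `&` pkneg x) \bot; first exact: lex1.
rewrite [pkneg _]pkB_neg_middle pkB_leE; apply/and3P; split; rewrite ?lexx //.
Qed.

(** If [x `&` pkneg x] or [y `&` pkneg y] is zero then both sides are the top.  Otherwise
  [pkC x] and [pkC y] are both the bottom of the middle chain, which has at most two
  elements. *)
Lemma pkB_symmetric_gamma m : (m <= 2)%N -> symmetric_gamma (pkB d i m).
Proof.
move=> m2 x y.
have min_rev (c : 'I_m.-1.+1) : c `&` rev_ord c = ord0.
  apply: le_anti; rewrite leIx.
  by move: c; clear x y; case: m m2 => [|[|[|//]]] _ [[|[|//]] ?].
have bot z w : z `&` pkneg z = \bot -> pkgamma w z = \top /\ pkgamma z w = \top :> pkB d i m.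
  move=> /pkC_kernel_bot Cz; rewrite /pkgamma /pkT Cz joinx1.
  by rewrite pkneg_top meetx0 pkstar_bot join1x.
have [/(bot _ y)[-> ->]//|x0] := eqVneq (x `&` pkneg x) \bot.
have [/(bot _ x)[-> ->]//|y0] := eqVneq (y `&` pkneg y) \bot.
have Cmid z : z `&` pkneg z != \bot -> pkC z = pkB_middle d i (ord0 : 'I_m.-1.+1).
  by move=> /pkC_pkB ->; rewrite min_rev.
by rewrite /pkgamma /pkT (Cmid x x0) (Cmid y y0).
Qed.

(** If [pkbeta x] is not the top, all the meets in it are nonzero: an atom [a] is below all
  the [x j], and atoms [b k] are below the [x j] with [j] different from [k] but not
  below [x k].  Then [b] is injective, hence surjective onto the [i] atoms, but misses
  [a]. *)
Lemma pkB_beta m : beta_identity (pkB d i m) i.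
Proof.
move=> x; apply: contrapT => xbeta.
have allF (F : 'I_i -> pkB d i m) : pkstar (\meet_j F j) <> \top ->
    exists a, forall j, a \in pkB_lo (F j).
  move=> F1; have [|a aF] := @pkB_atom m (\meet_j F j).
    by move=> F0; apply: F1; rewrite F0 pkstar_bot.
  by exists a => j; apply: pkB_lo_le aF; apply: meets_inf.
have [|a ax] := allF x; first by move=> x1; apply: xbeta; rewrite /pkbeta x1 join1x.
have /choice[b bx] k : exists b : 'I_i,
    forall j, b \in pkB_lo (if j == k then pkstar (x j) else x j).
  apply: allF => xk; apply: xbeta; apply/eqP; rewrite -le1x -xk.
  by apply: le_trans (leUr _ _); apply: (joins_sup (j := k)).
have bk k : b k \notin pkB_lo (x k).
  have xk0 : x k != \bot.
    by apply/eqP => xk0; have := ax k; rewrite xk0 finset.in_set0.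
  by have := bx k k; rewrite eqxx pkB_star_neq0 //= finset.in_setC.
have b_inj : injective b.
  move=> k l bkl; apply/eqP; apply: contraT => kl.
  by have := bk l; rewrite -bkl; have := bx k l; rewrite eq_sym (negPf kl) => ->.
by have := bk (invF b_inj a); rewrite f_invF ax.
Qed.

(** The quotient by the congruence that identifies the elements of the middle chain. *)
Definition collapse_middle m (x : pkB d i m) : pkB d i 1 :=
  pkB_of d (pkB_lo x) (ord0 : 'I_1.-1.+1) (pkB_up x).

Lemma collapse_middle_coords m (x : pkB d i m) :
  [/\ pkB_lo (collapse_middle x) = pkB_lo x,
      forall y : pkB d i 1, pkB_mid (collapse_middle x) = pkB_mid y
    & pkB_up (collapse_middle x) = pkB_up x].
Proof.
split; last exact: pkB_up_of.
  by apply: pkB_lo_of => // ux; apply: pkB_lo_eq1; rewrite ux orbT.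
by move=> y; rewrite [LHS]ord1 [RHS]ord1.
Qed.

Lemma collapse_middle_morphism m : pk_morphism (@collapse_middle m).
Proof.
have lo x : pkB_lo (@collapse_middle m x) = pkB_lo x by case: (collapse_middle_coords x).
have up x : pkB_up (@collapse_middle m x) = pkB_up x by case: (collapse_middle_coords x).
have ext x (y : pkB d i 1) : pkB_lo x = pkB_lo y -> pkB_up x = pkB_up y ->
    @collapse_middle m x = y.
  move=> xlo xup; have [lx mx ux] := collapse_middle_coords x.
  by apply: pkB_ext; rewrite ?lx ?ux.
split=> [x y|x y|||x|x]; apply: (ext) => //.
- by rewrite !pkB_loI !lo.
- by rewrite !pkB_upI !up.
- by rewrite !pkB_loU !lo.
- by rewrite !pkB_upU !up.
- by rewrite [LHS]pkB_lo_neg [RHS]pkB_lo_neg up.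
- by rewrite [LHS]pkB_up_neg [RHS]pkB_up_neg lo.
- have [->|x0] := eqVneq x \bot.
    by rewrite (ext \bot \bot erefl erefl) !pkstar_bot.
  have gx0 : collapse_middle x != \bot by rewrite (pkB_eq0 i_gt0) lo -(pkB_eq0 i_gt0).
  by rewrite !pkB_star_neq0 //= lo.
- have [->|x0] := eqVneq x \bot.
    by rewrite (ext \bot \bot erefl erefl) !pkstar_bot.
  have gx0 : collapse_middle x != \bot by rewrite (pkB_eq0 i_gt0) lo -(pkB_eq0 i_gt0).
  by rewrite !pkB_star_neq0.
Qed.

Lemma collapse_middle_surjective m y : exists x, @collapse_middle m x = y.
Proof.
pose c : 'I_m.-1.+1 := if pkB_up y != \bot then \top else \bot.
exists (pkB_of d (pkB_lo y) c (pkB_up y)).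
have [lx mx ux] := collapse_middle_coords (pkB_of d (pkB_lo y) c (pkB_up y)).
apply: pkB_ext => //; rewrite ?lx ?ux ?pkB_up_of // pkB_lo_of //.
  rewrite /c; case: ifP => [uy _|_]; last by rewrite eqxx.
  by apply: pkB_lo_eq1; rewrite uy orbT.
by move=> uy; apply: pkB_lo_eq1; rewrite uy orbT.
Qed.

Lemma pkB1_variety (V : pkAlgebraType d -> Prop) m :
  is_variety V -> V (pkB d i m) -> V (pkB d i 1).
Proof.
move=> [clH _ _]; apply: clH; first exact: collapse_middle_morphism.
exact: collapse_middle_surjective.
Qed.

Section Simplicity.
Context m (B : pkAlgebraType d) (f : pkB d i m -> B) (fM : pk_morphism f).

(** The negation of [pkstar u] is in the upper copy, above the whole middle chain. *)
Lemma collapse_bot u c : f u = \bot -> u <> \bot -> f (pkB_middle d i c) = \bot.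
Proof.
move=> fu u0; pose w := pkneg (pkstar u); have fw : f w = \bot.
  by rewrite (pk_morphN fM) (pk_morphS fM) fu pkstar_bot pkneg_top.
have /meet_idPl <- : pkB_middle d i c <= w.
  rewrite /w pkB_star_neq0; last exact/eqP.
  by rewrite [pkneg _]pkB_neg_lower pkB_leE /= !lex1 le0x.
by rewrite (pk_morphI fM) fw meetx0.
Qed.

(** For an atom below [y] but not below [x], the element [y `&` pkstar x] is nonzero and
  [f] maps it to zero. *)
Lemma collapse_lo x y c c' : f x = f y -> pkB_lo x <> pkB_lo y ->
  f (pkB_middle d i c) = f (pkB_middle d i c').
Proof.
suff main x' y' a : f x' = f y' -> a \in pkB_lo y' -> a \notin pkB_lo x' ->
    f (pkB_middle d i c) = f (pkB_middle d i c').
  move=> fxy lxy; have [xy|/fintype.subsetPn[a ax ay]] := boolP (pkB_lo x \subset pkB_lo y).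
    have [yx|/fintype.subsetPn[a ay ax]] := boolP (pkB_lo y \subset pkB_lo x).
      by case: lxy; apply/eqP; rewrite finset.eqEsubset xy yx.
    exact: main fxy ay ax.
  exact: main (esym fxy) ax ay.
move=> fxy ay ax; pose u := y' `&` pkstar x'.
have fu : f u = \bot by rewrite (pk_morphI fM) (pk_morphS fM) fxy pkstar_meet.
have u0 : u <> \bot.
  have au : a \in pkB_lo u.
    rewrite /u pkB_loI finset.in_setI ay /=.
    have [->|x0] := eqVneq x' \bot; first by rewrite pkstar_bot finset.in_setT.
    by rewrite pkB_star_neq0 // finset.in_setC.
  by move=> u0; rewrite u0 finset.in_set0 in au.
by rewrite !(collapse_bot _ fu u0).
Qed.

Lemma collapse_up x y c c' : f x = f y -> pkB_up x <> pkB_up y ->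
  f (pkB_middle d i c) = f (pkB_middle d i c').
Proof.
move=> fxy uxy; apply: (collapse_lo (x := pkneg x) (y := pkneg y)).
  by rewrite !(pk_morphN fM) fxy.
by move/compl_inj.
Qed.

End Simplicity.

(** The congruence that identifies the elements of the middle chain is the least nontrivial
  one: identified elements with different lower or upper coordinate collapse everything,
  and two identified elements of the chain give, by negation, a second pair. *)
Lemma pkB3_noninjective (B : pkAlgebraType d) (f : pkB d i 3 -> B) :
  pk_morphism f -> ~ injective f ->
  f (@pkB_middle d i 3 ord0) = f (@pkB_middle d i 3 ord_max).
Proof.
move=> fM; move=> /existsNP[x /existsNP[y /not_implyP[fxy xy]]].
have [lo_eq|] := eqVneq (pkB_lo x) (pkB_lo y); last by move/eqP; apply: collapse_lo fxy.
have [up_eq|] := eqVneq (pkB_up x) (pkB_up y); last by move/eqP; apply: collapse_up fxy.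
have mid_neq : pkB_mid x <> pkB_mid y by move=> mid_eq; apply: xy; apply: pkB_ext.
have lo1 : pkB_lo x = \top.
  have [mx|mx] := eqVneq (pkB_mid x) \bot; last by apply: pkB_lo_eq1; rewrite mx.
  by rewrite lo_eq; apply: pkB_lo_eq1; apply/orP; left; apply/eqP => my; rewrite mx my in mid_neq.
have up0 : pkB_up x = \bot.
  apply: contrapT => /eqP ux; apply: mid_neq.
  by rewrite !pkB_mid_eq1 -?up_eq.
have xE : x = pkB_middle d i (pkB_mid x) by apply: pkB_ext.
have yE : y = pkB_middle d i (pkB_mid y) by apply: pkB_ext; rewrite // -?lo_eq -?up_eq.
move: fxy mid_neq; rewrite xE yE; move: (pkB_mid x) (pkB_mid y) => c c'.
pose M k := f (@pkB_middle d i 3 (inord k)).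
have Mneg k l : (k < 3)%N -> (l < 3)%N -> M k = M l -> M (2 - k)%N = M (2 - l)%N.
  move=> k3 l3 kl.
  have rev j : (j < 3)%N -> M (2 - j)%N = pkneg (M j).
    move=> j3; rewrite /M -(pk_morphN fM) [pkneg _]pkB_neg_middle; congr (f (pkB_middle _ _ _)).
    by apply: val_inj; rewrite /= !inordK //; case: j j3 => [|[|[|]]].
  by rewrite !rev // kl.
have -> : (ord0 : 'I_3) = inord 0 by apply: val_inj; rewrite /= inordK.
have -> : (ord_max : 'I_3) = inord 2 by apply: val_inj; rewrite /= inordK.
have key k l : (k < 3)%N -> (l < 3)%N -> k <> l -> M k = M l -> M 0%N = M 2%N.
  move=> k3 l3 kl Mkl; have := Mneg _ _ k3 l3 Mkl; move: k3 l3 kl Mkl.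
  case: k => [|[|[|k]]] //; case: l => [|[|[|l]]] // _ _ _; rewrite !(subn0, subnn, subSS);
    by move=> E1 E2; rewrite -?E1 -?E2 // ?E1 -?E2.
move=> fcc' cc'; apply: (key c c') => //; first by move/val_inj.
by rewrite /M !inord_val.
Qed.

(** A subdirect embedding has to separate the ends of the middle chain. *)
Lemma pkB3_subdirectly_irreducible : subdirectly_irreducible (pkB d i 3).
Proof.
move=> I A f fM _ sep; apply: contrapT => noinj.
have /(congr1 (@pkB_mid _ _ _)) // : @pkB_middle d i 3 ord0 = @pkB_middle d i 3 ord_max.
apply: sep => j; apply: pkB3_noninjective => // finj; apply: noinj; by exists j.
Qed.

End BIdentities.

(** * The six characterizations *)

Section Characterizations.
Context (d : Order.disp_t) (L : pkAlgebraType d).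

Lemma BPK_identity : BPK L <-> bundle_identity L.
Proof.
have varB : is_variety (@BPK d) by apply: variety_of_variety.
split=> [|eqL].
  apply: variety_of_sub; first exact: bundle_identity_variety_class.
  by move=> A [_ /bundle_satisfies_identity].
have B3 i : (0 < i)%N -> BPK (pkB d i 3).
  move=> i_gt0; apply: variety_of_gen; split; last exact: pkB_bundle.
  exact: pkB3_subdirectly_irreducible.
apply: (bundle_identity_variety varB _ eqL (@clusters_covered_pos d L) (@middle_chains3 d L)).
by move=> i i_gt0; split=> //; [apply: (pkB1_variety i_gt0 varB) |]; apply: B3.
Qed.

Lemma BPK1_identity : BPK1 L <-> symmetric_gamma L.
Proof.
have varB : is_variety (@BPK1 d) by apply: variety_of_variety.
split=> [|eqL].
  apply: variety_of_sub; first exact: symmetric_gamma_variety_class.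
  by move=> A [i i_gt0 [] ->]; apply: pkB_symmetric_gamma.
apply: (bundle_identity_variety varB _ (symmetric_gamma_bundle eqL)
  (@clusters_covered_pos d L) (middle_chains2 eqL)).
by move=> i i_gt0; split=> //; apply: variety_of_gen; exists i => //; [left | right].
Qed.

Lemma BPK0_identity : BPK0 L <-> bundle_identity L /\ no_middle_identity L.
Proof.
have varB : is_variety (@BPK0 d) by apply: variety_of_variety.
split=> [|[eqL eqC]].
  apply: (variety_of_sub (V := fun A => bundle_identity A /\ no_middle_identity A)).
    exact: varietyI (@bundle_identity_variety_class d) (@no_middle_identity_variety_class d).
  move=> A [i i_gt0 ->]; split; last exact: pkB_no_middle.
  exact: (bundle_satisfies_identity (pkB_bundle i_gt0 (m := 1))).
apply: (bundle_identity_variety varB _ eqL (@clusters_covered_pos d L) (middle_chains1 eqC)).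
by move=> i i_gt0; split=> //; apply: variety_of_gen; exists i.
Qed.

Section FixedSize.
Context (n : nat) (n_gt0 : (0 < n)%N).

Lemma pkB_variety_sub (m : nat) (V : pkAlgebraType d -> Prop) :
  is_variety V -> V (pkB d n m) -> pkB_variety n m L -> V L.
Proof. by move=> varV VB; apply: variety_of_sub => // A ->. Qed.

Lemma pkB_variety_complete m : bundle_identity L -> beta_identity L n ->
  middle_chains L m -> pkB_variety n m L.
Proof.
move=> eqL eqB mid; have varB : is_variety (@pkB_variety d n m) by apply: variety_of_variety.
apply: (bundle_identity_variety varB _ eqL (beta_clusters_covered eqB) mid).
have Bnm : pkB_variety n m (pkB d n m) by apply: variety_of_gen.
by move=> _ <-; split=> //; apply: pkB1_variety varB Bnm.
Qed.

Lemma pkB_variety_beta m : pkB_variety n m L -> beta_identity L n.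
Proof.
apply: (pkB_variety_sub (V := fun A => beta_identity A n)); last exact: pkB_beta.
exact: beta_identity_variety_class.
Qed.

Lemma pkB_variety_bundle m : pkB_variety n m L -> bundle_identity L.
Proof.
apply: (pkB_variety_sub (V := @bundle_identity d)); first exact: bundle_identity_variety_class.
exact: (bundle_satisfies_identity (pkB_bundle n_gt0 (m := m))).
Qed.

Lemma pkB_variety1_identity : pkB_variety n 1 L <->
  bundle_identity L /\ no_middle_identity L /\ beta_identity L n.
Proof.
split=> [VL|[eqL [eqC eqB]]]; last exact: pkB_variety_complete eqL eqB (middle_chains1 eqC).
split; [exact: pkB_variety_bundle VL | split; last exact: pkB_variety_beta VL].
apply: (pkB_variety_sub (V := @no_middle_identity d)) VL; last exact: pkB_no_middle.
exact: no_middle_identity_variety_class.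
Qed.

Lemma pkB_variety2_identity :
  pkB_variety n 2 L <-> symmetric_gamma L /\ beta_identity L n.
Proof.
split=> [VL|[eqL eqB]].
  split; last exact: pkB_variety_beta VL.
  apply: (pkB_variety_sub (V := @symmetric_gamma d)) VL; last exact: pkB_symmetric_gamma.
  exact: symmetric_gamma_variety_class.
exact: pkB_variety_complete (symmetric_gamma_bundle eqL) eqB (middle_chains2 eqL).
Qed.

Lemma pkB_variety3_identity :
  pkB_variety n 3 L <-> bundle_identity L /\ beta_identity L n.
Proof.
split=> [VL|[eqL eqB]]; last exact: pkB_variety_complete eqL eqB (@middle_chains3 d L).
by split; [apply: pkB_variety_bundle VL | apply: pkB_variety_beta VL].
Qed.

End FixedSize.
End Characterizations.

Theorem theorem6p5 (d : Order.disp_t) (L : pkAlgebraType d) (n : nat) (hn : (0 < n)%N) :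
  (BPK L <-> (forall x y : L, pkstar x `&` pkgamma x y = pkstar x)) /\
  (BPK1 L <-> (forall x y : L, pkgamma y x = pkgamma x y)) /\
  (BPK0 L <->
     (forall x y : L, pkstar x `&` pkgamma x y = pkstar x) /\
     (forall x : L, pkC x `&` pkneg (pkC x) = pkneg (pkC x))) /\
  (pkB_variety n 1 L <->
     (forall x y : L, pkstar x `&` pkgamma x y = pkstar x) /\
     (forall x : L, pkC x `&` pkneg (pkC x) = pkneg (pkC x)) /\
     (forall x : 'I_n -> L, pkbeta x = \top)) /\
  (pkB_variety n 2 L <->
     (forall x y : L, pkgamma y x = pkgamma x y) /\
     (forall x : 'I_n -> L, pkbeta x = \top)) /\
  (pkB_variety n 3 L <->
     (forall x y : L, pkstar x `&` pkgamma x y = pkstar x) /\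
     (forall x : 'I_n -> L, pkbeta x = \top)).
Proof.
split; first exact: BPK_identity.
split; first exact: BPK1_identity.
split; first exact: BPK0_identity.
split; first exact: pkB_variety1_identity.
by split; [exact: pkB_variety2_identity | exact: pkB_variety3_identity].
Qed.
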